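(* Let $E$ be a Henselian valued field with residue characteristic $p>0$ and let $L$ be a purely wild finite-dimensional graded field extension of $GE$. Then there is a defectless (finite-dimensional) field extension $K$ of $E$ such that $GK=L$ (i.e. $GK$ and $L$ are isomorphic as graded field extensions of $GE$). If $\mathrm{char}(E)=p$, then $K$ can be chosen to be a purely inseparable field extension of $E$.
   Context: For a valued field $(E,v)$ and $\gamma$ in its value group $\Gamma_E$, put $E^{\gamma}=\{x: v(x)\ge\gamma\}$, $E^{>\gamma}=\{x: v(x)>\gamma\}$, $GE_\gamma=E^\gamma/E^{>\gamma}$; for $x\ne0$ let $\widetilde x=x+E^{>v(x)}\in GE_{v(x)}$. The associated graded field is $GE=\bigoplus_\gamma GE_\gamma$ with multiplication $\widetilde{x}\,\widetilde{y}=\widetilde{xy}$. For a finite extension $K$ of the Henselian field $E$, $K$ carries the unique extension of $v$, and $GK\supseteq GE$ canonically. A graded field is a (nonzero) commutative ring $F=\bigoplus_{\gamma\in\Gamma}F_\gamma$ graded by a totally ordered abelian group $\Gamma$ in which every nonzero homogeneous element is invertible; $\Gamma_F=\{\gamma: F_\gamma\neq0\}$, and $F_0$ is a field. A graded field extension $L$ of $F$ is a graded field containing $F$ with $F_\gamma\subseteq L_\gamma$ for all $\gamma$ (gradings in a common totally ordered abelian group); $L$ is a free $F$-module and $[L:F]$ is its rank. A finite-dimensional graded field extension $L/F$ is purely wild if $\mathrm{char}(F)=p\neq0$, $L_0$ is purely inseparable over $F_0$, and $\Gamma_L/\Gamma_F$ is a $p$-group. A finite extension $K/E$ is defectless if $[K:E]=[\overline{K}:\overline{E}]\,|\Gamma_K:\Gamma_E|$,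 where bars denote residue fields. *)

(* Defs.v *)
From HB Require Import structures.
From mathcomp Require Import all_boot all_order all_algebra all_field.
From mathcomp Require Import finmap multinomials.monalg.
Set Implicit Arguments.
Unset Strict Implicit.
Unset Printing Implicit Defensive.
Import Order.TTheory GRing.Theory Num.Theory.
Local Open Scope fset_scope.
Local Open Scope ring_scope.

(* Totality is a mixin field, not an instance of Order.Total: joining the
   latter with zmodules would require declaring structures upstream of
   Num.RealDomain. *)
HB.mixin Record isOrderedGroup (G : Type) of Num.POrderedZmodule G := {
  ogle_total : total (<=%R : rel G);
  ogle_add2l : forall z x y : G, x <= y -> z + x <= z + y
}.

#[short(type="ordGroupType")]
HB.structure Definition OrderedGroup :=
  {G of isOrderedGroup G & Num.POrderedZmodule G}.

Section OrderedGroupTheory.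
Variable G : ordGroupType.
Implicit Types x y z : G.

Lemma ogle_add z x y : (z + x <= z + y) = (x <= y).
Proof.
apply/idP/idP => [/(ogle_add2l (- z))|/ogle_add2l//].
by rewrite !addKr.
Qed.

Lemma oglt_add z x y : (z + x < z + y) = (x < y).
Proof. by rewrite !lt_def ogle_add (can_eq (addKr z)). Qed.

Lemma oglt_leNgt x y : (x < y) = ~~ (y <= x).
Proof.
rewrite lt_leAnge andb_idl // => nyx.
by have /orP[|yx] := ogle_total x y => //; rewrite yx in nyx.
Qed.

Lemma ogle_leNgt x y : (x <= y) = ~~ (y < x).
Proof. by rewrite oglt_leNgt negbK. Qed.

Lemma ogle_addD x y z t : x <= y -> z <= t -> x + z <= y + t.
Proof.
move=> xy zt; apply: (@le_trans _ _ (x + t)); first by rewrite ogle_add.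
by rewrite ![_ + t]addrC ogle_add.
Qed.

Lemma oglt_leD x y z t : x < y -> z <= t -> x + z < y + t.
Proof.
move=> xy zt; apply: (@le_lt_trans _ _ (x + t)); first by rewrite ogle_add.
by rewrite ![_ + t]addrC oglt_add.
Qed.

Lemma og_double0 x : x + x = 0 -> x = 0.
Proof.
move=> xx; have /orP[h|h] := ogle_total 0 x; apply/eqP;
  rewrite eq_le h ?andbT /=; have := ogle_add2l x _ _ h;
  by rewrite xx addr0.
Qed.

End OrderedGroupTheory.

(* The value at 0 is unspecified: it stands for the symbol oo, and no
   definition below depends on it. *)
Record valuation (E : fieldType) (G : ordGroupType) := Valuation {
  val_fun :> E -> G;
  val_mul : forall x y, x != 0 -> y != 0 ->
    val_fun (x * y) = val_fun x + val_fun y;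
  val_add : forall x y, x != 0 -> y != 0 -> x + y != 0 ->
    Num.min (val_fun x) (val_fun y) <= val_fun (x + y)
}.

Section Valuation.
Variables (E : fieldType) (G : ordGroupType) (v : valuation E G).
Implicit Types (x y : E) (a b : G).

Definition vge a x := (x == 0) || (a <= v x).
Definition vgt a x := (x == 0) || (a < v x).
Definition value_group a := exists2 x, x != 0 & v x = a.

Lemma val1 : v 1 = 0.
Proof.
have h : v 1 + v 1 = v 1 + 0 by rewrite -val_mul ?oner_eq0 // mulr1 addr0.
exact: addrI h.
Qed.

Lemma valN x : x != 0 -> v (- x) = v x.
Proof.
move=> x0; rewrite -mulN1r val_mul ?oppr_eq0 ?oner_eq0 //.
suff -> : v (-1) = 0 by rewrite add0r.
apply: og_double0; rewrite -val_mul ?oppr_eq0 ?oner_eq0 //.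
by rewrite mulN1r opprK val1.
Qed.

Lemma valV x : x != 0 -> v x^-1 = - v x.
Proof.
move=> x0; apply: (addrI (v x)).
by rewrite -val_mul ?invr_eq0 // mulfV // val1 subrr.
Qed.

Lemma vge0 a : vge a 0. Proof. by rewrite /vge eqxx. Qed.
Lemma vgt0 a : vgt a 0. Proof. by rewrite /vgt eqxx. Qed.
Lemma vge01 : vge 0 1. Proof. by rewrite /vge val1 lexx orbT. Qed.
Lemma vgt01 : vgt 0 1 = false.
Proof. by rewrite /vgt val1 ltxx oner_eq0. Qed.
Lemma vgtW a x : vgt a x -> vge a x.
Proof. by case/orP=> [/eqP->|/ltW h]; rewrite ?vge0 // /vge h orbT. Qed.

Lemma vgeN a x : vge a (- x) = vge a x.
Proof. by rewrite /vge oppr_eq0; case: eqVneq => //= /valN->. Qed.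
Lemma vgtN a x : vgt a (- x) = vgt a x.
Proof. by rewrite /vgt oppr_eq0; case: eqVneq => //= /valN->. Qed.

Lemma vgeD a x y : vge a x -> vge a y -> vge a (x + y).
Proof.
have [->|x0] := eqVneq x 0; first by rewrite add0r.
have [->|y0] := eqVneq y 0; first by rewrite addr0.
rewrite /vge (negPf x0) (negPf y0) /= => ax ay.
have [//|xy0 /=] := eqVneq (x + y) 0; apply: le_trans (val_add v x0 y0 xy0).
by rewrite /Order.min; case: ifP.
Qed.

Lemma vgtD a x y : vgt a x -> vgt a y -> vgt a (x + y).
Proof.
have [->|x0] := eqVneq x 0; first by rewrite add0r.
have [->|y0] := eqVneq y 0; first by rewrite addr0.
rewrite /vgt (negPf x0) (negPf y0) /= => ax ay.
have [//|xy0 /=] := eqVneq (x + y) 0; apply: lt_le_trans (val_add v x0 y0 xy0).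
by rewrite /Order.min; case: ifP.
Qed.

Lemma vgeM a b x y : vge a x -> vge b y -> vge (a + b) (x * y).
Proof.
have [->|x0] := eqVneq x 0; first by move=> _ _; rewrite mul0r vge0.
have [->|y0] := eqVneq y 0; first by move=> _ _; rewrite mulr0 vge0.
rewrite /vge mulf_eq0 (negPf x0) (negPf y0) /= => ax ay.
by rewrite val_mul // ogle_addD.
Qed.

Lemma vgtM a b x y : vgt a x -> vge b y -> vgt (a + b) (x * y).
Proof.
have [->|x0] := eqVneq x 0; first by move=> _ _; rewrite mul0r vgt0.
have [->|y0] := eqVneq y 0; first by move=> _ _; rewrite mulr0 vgt0.
rewrite /vgt /vge mulf_eq0 (negPf x0) (negPf y0) /= => ax ay.
by rewrite val_mul // oglt_leD.
Qed.

Lemma vge_sum a I (r : seq I) (P : pred I) (F : I -> E) :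
  (forall i, P i -> vge a (F i)) -> vge a (\sum_(i <- r | P i) F i).
Proof. by move=> h; elim/big_ind: _ => //; [exact: vge0 | exact: vgeD]. Qed.

Lemma vgt_sum a I (r : seq I) (P : pred I) (F : I -> E) :
  (forall i, P i -> vgt a (F i)) -> vgt a (\sum_(i <- r | P i) F i).
Proof. by move=> h; elim/big_ind: _ => //; [exact: vgt0 | exact: vgtD]. Qed.

Definition val_ring_pred : {pred E} := vge 0.

Lemma val_ringE x : (x \in val_ring_pred) = vge 0 x. Proof. by []. Qed.

Fact val_ring_closed : subring_closed val_ring_pred.
Proof.
split=> [|x y|x y]; rewrite ?val_ringE; first exact: vge01.
  by move=> xO yO; rewrite vgeD ?vgeN.
by move=> xO yO; have := vgeM xO yO; rewrite addr0.
Qed.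
HB.instance Definition _ :=
  GRing.isSubringClosed.Build E val_ring_pred val_ring_closed.

Record val_ring := ValRing { vr_val :> E; _ : vr_val \in val_ring_pred }.
HB.instance Definition _ := [isSub for vr_val].
HB.instance Definition _ := [Choice of val_ring by <:].
HB.instance Definition _ := [SubChoice_isSubComNzRing of val_ring by <:].

Definition val_ideal : {pred val_ring} := fun u => vgt 0 (val u).

Lemma val_idealE (u : val_ring) : (u \in val_ideal) = vgt 0 (val u).
Proof. by []. Qed.

Fact val_ideal_closed : idealr_closed val_ideal.
Proof.
split=> [||a x y]; rewrite ?val_idealE.
- by rewrite rmorph0 vgt0.
- by rewrite rmorph1 vgt01.
move=> xI yI; rewrite rmorphD rmorphM vgtD // mulrC.
have aO : vge 0 (val a) by rewrite -val_ringE; exact: valP.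
by have := vgtM xI aO; rewrite addr0.
Qed.
HB.instance Definition _ := isIdealr.Build val_ring val_ideal val_ideal_closed.

Definition residue_field := {ideal_quot val_ideal}.
HB.instance Definition _ := GRing.ComNzRing.on residue_field.
Definition residue (u : val_ring) : residue_field :=
  \pi_({ideal_quot val_ideal})%qT u.

Lemma residue_is_zmod_morphism : zmod_morphism residue.
Proof. exact: rmorphB. Qed.
Lemma residue_is_monoid_morphism : monoid_morphism residue.
Proof. by split; [exact: rmorph1 | exact: rmorphM]. Qed.
HB.instance Definition _ := GRing.isZmodMorphism.Build val_ring residue_field
  residue residue_is_zmod_morphism.
HB.instance Definition _ := GRing.isMonoidMorphism.Build val_ring residue_field
  residue residue_is_monoid_morphism.

Definition res_repr (r : residue_field) : val_ring := repr r.
Lemma res_reprK : cancel res_repr residue.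
Proof. by move=> r; rewrite /residue /res_repr reprK. Qed.

Lemma residue_eq0 (u : val_ring) : (residue u == 0) = vgt 0 (val u).
Proof.
rewrite -val_idealE -[u in RHS]subr0 Quotient.idealrBE.
by rewrite -[0 in LHS](rmorph0 residue).
Qed.

Definition residue_inv (r : residue_field) : residue_field :=
  if r == 0 then 0 else residue (insubd 0 (val (res_repr r))^-1).

Fact residue_mulVf r : r != 0 -> residue_inv r * r = 1.
Proof.
rewrite /residue_inv => r0; rewrite (negPf r0).
move: r0; rewrite -{1 3}[r]res_reprK; move: (res_repr r) => u.
rewrite residue_eq0 /vgt negb_or -ogle_leNgt => /andP[u0 uv].
have uO : (val u)^-1 \in val_ring_pred.
  by rewrite val_ringE /vge invr_eq0 valV // (negPf u0) -(ogle_add (v (val u))) subrr addr0.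
rewrite -rmorphM -(rmorph1 residue); congr (residue _).
by apply: val_inj; rewrite rmorphM rmorph1 /= insubdK // mulVf.
Qed.

Fact residue_inv0 : residue_inv 0 = 0.
Proof. by rewrite /residue_inv eqxx. Qed.

HB.instance Definition _ :=
  GRing.ComNzRing_isField.Build residue_field residue_mulVf residue_inv0.

End Valuation.

(* Group algebra R[G] of a commutative ring R over an additive group G. The
   product of {malg R[G]} is not available here: it needs a monoid of indices
   without nontrivial units. *)
Section GroupAlgebra.
Variables (G : zmodType) (R : comNzRingType).

Definition galg := {malg R[G]}.
HB.instance Definition _ := GRing.Zmodule.on galg.

Implicit Types (f g h : galg) (a b : G) (x y : R).

Definition galg_one : galg := << 1 *g 0 >>.
Definition galg_mul_def f g : galg :=
  \sum_(a <- msupp f) \sum_(b <- msupp g) << f@_a * g@_b *g (a + b) >>.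
Fact galg_key : unit. Proof. by []. Qed.
Definition galg_mul := locked_with galg_key galg_mul_def.

Lemma galg_mulE f g : galg_mul f g =
  \sum_(a <- msupp f) \sum_(b <- msupp g) << f@_a * g@_b *g (a + b) >>.
Proof. by rewrite /galg_mul unlock. Qed.

Lemma galg_mulw (d1 d2 : {fset G}) f g :
  msupp f `<=` d1 -> msupp g `<=` d2 ->
  galg_mul f g = \sum_(a <- d1) \sum_(b <- d2) << f@_a * g@_b *g (a + b) >>.
Proof.
move=> le1 le2; rewrite galg_mulE (big_fset_incl _ le1) /=.
  apply/eq_bigr=> a _; apply/big_fset_incl => // b _ /mcoeff_outdom ->.
  by rewrite mulr0 monalgU0.
move=> a _ /mcoeff_outdom fa.
by rewrite big1 // => b _; rewrite fa mul0r monalgU0.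
Qed.

Lemma galg_mulC : commutative galg_mul.
Proof.
move=> f g; rewrite !galg_mulE exchange_big /=.
by apply/eq_bigr=> a _; apply/eq_bigr=> b _; rewrite mulrC addrC.
Qed.

Lemma galg_mulDl : left_distributive galg_mul +%R.
Proof.
move=> f g h.
rewrite (galg_mulw (msuppD_le f g) (fsubset_refl _)).
rewrite (galg_mulw (fsubsetUl _ (msupp g)) (fsubset_refl _)).
rewrite (galg_mulw (fsubsetUr (msupp f) _) (fsubset_refl _)).
rewrite -big_split /=; apply/eq_bigr=> a _.
rewrite -big_split /=; apply/eq_bigr=> b _.
by rewrite mcoeffD mulrDl monalgUD.
Qed.

Lemma galg_mul0 f : galg_mul 0 f = 0.
Proof. by rewrite galg_mulE msupp0 big_seq_fset0. Qed.

Lemma galg_mulUU x y a b :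
  galg_mul << x *g a >> << y *g b >> = << x * y *g (a + b) >>.
Proof. by rewrite (galg_mulw msuppU_le msuppU_le) !big_seq_fset1 !mcoeffUU. Qed.

Lemma galg_mul1 : left_id galg_one galg_mul.
Proof.
move=> g; rewrite (galg_mulw msuppU_le (fsubset_refl _)) big_seq_fset1.
rewrite [RHS]monalgE; apply/eq_bigr=> b _.
by rewrite mcoeffUU mul1r add0r.
Qed.

Lemma galg_mul_suml I (r : seq I) (F : I -> galg) g :
  galg_mul (\sum_(i <- r) F i) g = \sum_(i <- r) galg_mul (F i) g.
Proof.
exact: (big_morph (galg_mul^~ g) (fun f h => galg_mulDl f h g) (galg_mul0 g)).
Qed.

Lemma galg_mul_sumr I (r : seq I) (F : I -> galg) g :
  galg_mul g (\sum_(i <- r) F i) = \sum_(i <- r) galg_mul g (F i).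
Proof.
by rewrite galg_mulC galg_mul_suml; apply/eq_bigr => i _; rewrite galg_mulC.
Qed.

Lemma galg_mulA : associative galg_mul.
Proof.
move=> f g h; rewrite [f]monalgE [g]monalgE [h]monalgE.
rewrite !galg_mul_suml; apply/eq_bigr=> a _.
rewrite galg_mul_sumr [X in _ = galg_mul X _]galg_mul_sumr galg_mul_suml; apply/eq_bigr=> b _.
rewrite !galg_mul_sumr; apply/eq_bigr=> c _.
by rewrite !galg_mulUU mulrA addrA.
Qed.

Lemma galg_one_neq0 : galg_one != 0.
Proof. by rewrite monalgU_eq0 oner_eq0. Qed.

HB.instance Definition _ := GRing.Zmodule_isComNzRing.Build galg
  galg_mulA galg_mulC galg_mul1 galg_mulDl galg_one_neq0.

Lemma galgE f : f = \sum_(a <- msupp f) (<< f@_a *g a >> : galg).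
Proof. exact: monalgE. Qed.

Lemma galg_coefM f g c : (f * g)@_c =
  \sum_(a <- msupp f) \sum_(b <- msupp g) (f@_a * g@_b) *+ (a + b == c).
Proof.
rewrite [f * g]galg_mulE raddf_sum /=; apply/eq_bigr=> a _.
by rewrite raddf_sum /=; apply/eq_bigr=> b _; rewrite mcoeffU.
Qed.

Lemma galgUM x y a b :
  (<< x *g a >> : galg) * << y *g b >> = << x * y *g (a + b) >>.
Proof. exact: galg_mulUU. Qed.

Lemma galg_coef1 c : (1 : galg)@_c = (c == 0)%:R.
Proof. by rewrite mcoeffU eq_sym. Qed.

End GroupAlgebra.

Section GroupAlgebraMap.
Variables (G : zmodType) (R S : comNzRingType) (phi : {rmorphism R -> S}).

Definition galg_map (f : galg G R) : galg G S :=
  \sum_(a <- msupp f) << phi (f@_a) *g a >>.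

Lemma galg_coef_map f c : (galg_map f)@_c = phi (f@_c).
Proof.
rewrite {2}[f]galgE !raddf_sum; apply/eq_bigr=> a _ /=.
by rewrite !mcoeffU rmorphMn.
Qed.

Lemma galg_mapU x a : galg_map << x *g a >> = << phi x *g a >>.
Proof. by apply/malgP=> c; rewrite galg_coef_map !mcoeffU rmorphMn. Qed.

Fact galg_map_zmod : zmod_morphism galg_map.
Proof.
by move=> f g; apply/malgP=> c; rewrite !(mcoeffB, galg_coef_map) rmorphB.
Qed.

HB.instance Definition _ :=
  GRing.isZmodMorphism.Build (galg G R) (galg G S) galg_map galg_map_zmod.

Fact galg_map_monoid : monoid_morphism galg_map.
Proof.
split=> [|f g]; first by rewrite galg_mapU rmorph1.
rewrite [f]galgE [g]galgE.
rewrite mulr_suml !raddf_sum [RHS]mulr_suml; apply/eq_bigr=> a _.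
rewrite mulr_sumr raddf_sum [RHS]mulr_sumr; apply/eq_bigr=> b _ /=.
by rewrite galgUM !galg_mapU galgUM rmorphM.
Qed.

HB.instance Definition _ :=
  GRing.isMonoidMorphism.Build (galg G R) (galg G S) galg_map galg_map_monoid.

End GroupAlgebraMap.

Record is_grading (G : ordGroupType) (R : comNzRingType) (H : G -> R -> Prop) :
    Prop := IsGrading {
  hom0 : forall a, H a 0;
  homB : forall a x y, H a x -> H a y -> H a (x - y);
  hom1 : H 0 1;
  homM : forall a b x y, H a x -> H b y -> H (a + b) (x * y);
  hom_span : forall x, exists (s : {fset G}) (f : G -> R),
    (forall a, H a (f a)) /\ x = \sum_(a <- s) f a;
  hom_indep : forall (s : {fset G}) (f : G -> R), (forall a, H a (f a)) ->
    \sum_(a <- s) f a = 0 -> forall a, a \in s -> f a = 0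
}.

Record gradedField (G : ordGroupType) := GradedField {
  gf_ring :> comNzRingType;
  gf_hom : G -> gf_ring -> Prop;
  gf_grading : is_grading gf_hom;
  gf_unit : forall a x, gf_hom a x -> x != 0 -> exists y, x * y = 1
}.

Definition gf_supp (G : ordGroupType) (F : gradedField G) (a : G) :=
  exists2 x : F, x != 0 & gf_hom a x.

(* Associated graded field: with A = (+)_a E^a X^a, a subring of the group
   algebra E[G], and I = (+)_a E^{>a} X^a, an ideal of A, it is the quotient
   A / I = (+)_a E^a / E^{>a}. *)
Section AssociatedGraded.
Variables (E : fieldType) (G : ordGroupType) (v : valuation E G).
Implicit Types (x y : E) (a b : G).

Definition rees_pred : {pred galg G E} :=
  fun f => all (fun a => vge v a (f@_a)) (msupp f).

Lemma reesP (f : galg G E) :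
  reflect (forall a, vge v a (f@_a)) (f \in rees_pred).
Proof.
apply: (iffP allP) => h a; last by move=> _; exact: h.
by case: (msuppP f a) => // [/h|_]; rewrite ?vge0.
Qed.

Fact rees_closed : subring_closed rees_pred.
Proof.
split=> [|f g /reesP hf /reesP hg|f g /reesP hf /reesP hg]; apply/reesP => c.
- by rewrite galg_coef1; case: eqVneq => [->|_]; rewrite ?vge01 ?vge0.
- by rewrite mcoeffB vgeD ?vgeN.
rewrite galg_coefM; apply: vge_sum => a _; apply: vge_sum => b _.
by case: eqVneq => [<-|_]; rewrite ?vge0 // vgeM.
Qed.
HB.instance Definition _ :=
  GRing.isSubringClosed.Build (galg G E) rees_pred rees_closed.

Record rees := Rees { rees_val :> galg G E; _ : rees_val \in rees_pred }.
HB.instance Definition _ := [isSub for rees_val].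
HB.instance Definition _ := [Choice of rees by <:].
HB.instance Definition _ := [SubChoice_isSubComNzRing of rees by <:].

Definition rees_ideal : {pred rees} :=
  fun f => all (fun a => vgt v a ((val f)@_a)) (msupp (val f)).

Lemma rees_idealP (f : rees) :
  reflect (forall a, vgt v a ((val f)@_a)) (f \in rees_ideal).
Proof.
apply: (iffP allP) => h a; last by move=> _; exact: h.
by case: (msuppP (val f) a) => // [/h|_]; rewrite ?vgt0.
Qed.

Fact rees_ideal_closed : idealr_closed rees_ideal.
Proof.
split=> [||h f g /rees_idealP hf /rees_idealP hg].
- by apply/rees_idealP => a; rewrite rmorph0 mcoeff0 vgt0.
- apply/rees_idealP => /(_ 0); rewrite rmorph1 galg_coef1 eqxx.
  by rewrite vgt01.
apply/rees_idealP => c; rewrite rmorphD rmorphM mcoeffD vgtD //.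
rewrite mulrC galg_coefM; apply: vgt_sum => a _; apply: vgt_sum => b _.
case: eqVneq => [<-|_]; rewrite ?vgt0 // vgtM //.
by have /reesP := valP h.
Qed.
HB.instance Definition _ := isIdealr.Build rees rees_ideal rees_ideal_closed.

Definition gr_ring := {ideal_quot rees_ideal}.
HB.instance Definition _ := GRing.ComNzRing.on gr_ring.
Definition gr_pi (f : rees) : gr_ring := \pi_({ideal_quot rees_ideal})%qT f.

Lemma gr_pi_is_zmod_morphism : zmod_morphism gr_pi.
Proof. exact: rmorphB. Qed.
Lemma gr_pi_is_monoid_morphism : monoid_morphism gr_pi.
Proof. by split; [exact: rmorph1 | exact: rmorphM]. Qed.
HB.instance Definition _ := GRing.isZmodMorphism.Build rees gr_ring
  gr_pi gr_pi_is_zmod_morphism.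
HB.instance Definition _ := GRing.isMonoidMorphism.Build rees gr_ring
  gr_pi gr_pi_is_monoid_morphism.

Definition gr_repr (r : gr_ring) : rees := repr r.
Lemma gr_reprK : cancel gr_repr gr_pi.
Proof. by move=> r; rewrite /gr_pi /gr_repr reprK. Qed.

Lemma gr_pi_eq0 (f : rees) : (gr_pi f == 0) = (f \in rees_ideal).
Proof.
rewrite -[f in RHS]subr0 Quotient.idealrBE.
by rewrite -[0 in LHS](rmorph0 gr_pi).
Qed.

Definition rees_mon a x : rees := insubd 0 (<< x *g a >> : galg G E).

Lemma rees_monE a x : vge v a x -> rees_val (rees_mon a x) = << x *g a >>.
Proof.
move=> ax; rewrite -[LHS]/(val _) /rees_mon insubdK //; apply/reesP => c.
by rewrite mcoeffU; case: eqVneq => [<-|_]; rewrite ?vge0.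
Qed.

(* The class of x in E^a / E^{>a}, of use for v x >= a only. *)
Definition gr_class a x : gr_ring := gr_pi (rees_mon a x).

Lemma gr_class_eq0 a x : vge v a x -> (gr_class a x == 0) = vgt v a x.
Proof.
move=> ax; rewrite gr_pi_eq0; apply/rees_idealP/idP => [/(_ a)|h c].
  by rewrite /= rees_monE // mcoeffUU.
by rewrite /= rees_monE // mcoeffU; case: eqVneq => [<-|_]; rewrite ?vgt0.
Qed.

Lemma gr_classB a x y : vge v a x -> vge v a y ->
  gr_class a (x - y) = gr_class a x - gr_class a y.
Proof.
move=> ax ay; rewrite -rmorphB; congr gr_pi; apply: val_inj.
by rewrite rmorphB /= !rees_monE ?vgeD ?vgeN // monalgUB.
Qed.

Lemma gr_class0 a : gr_class a 0 = 0.
Proof. by apply/eqP; rewrite gr_class_eq0 ?vgt0 ?vge0. Qed.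

Lemma gr_classM a b x y : vge v a x -> vge v b y ->
  gr_class (a + b) (x * y) = gr_class a x * gr_class b y.
Proof.
move=> ax ay; rewrite -rmorphM; congr gr_pi; apply: val_inj.
by rewrite rmorphM /= !rees_monE ?vgeM // galgUM.
Qed.

Lemma gr_class1 : gr_class 0 1 = 1.
Proof.
rewrite -(rmorph1 gr_pi); congr gr_pi; apply: val_inj.
by rewrite /= rees_monE ?vge01 // rmorph1.
Qed.

Definition gr_hom a (r : gr_ring) := exists2 x, vge v a x & r = gr_class a x.

Lemma gr_piE (f : rees) :
  gr_pi f = \sum_(a <- msupp (val f)) gr_class a ((val f)@_a).
Proof.
have /reesP hf := valP f.
rewrite -[RHS](rmorph_sum gr_pi); congr gr_pi; apply: val_inj.
rewrite rmorph_sum [LHS]galgE; apply: eq_bigr => a _.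
by rewrite /= rees_monE.
Qed.

Fact gr_grading : is_grading gr_hom.
Proof.
split.
- by move=> a; exists 0; rewrite ?vge0 ?gr_class0.
- move=> a _ _ [x ax ->] [y ay ->]; exists (x - y); first by rewrite vgeD ?vgeN.
  by rewrite gr_classB.
- by exists 1; rewrite ?vge01 ?gr_class1.
- move=> a b _ _ [x ax ->] [y ay ->]; exists (x * y); first exact: vgeM.
  by rewrite gr_classM.
- move=> r; rewrite -[r]gr_reprK; move: (gr_repr r) => f.
  exists (msupp (val f)), (fun a => gr_class a ((val f)@_a)); split.
    by move=> a; exists ((val f)@_a) => //; have /reesP := valP f.
  exact: gr_piE.
move=> s F hF s0 a sa.
have hG b : exists x, vge v b x && (F b == gr_class b x).
  by have [x bx ->] := hF b; exists x; rewrite bx eqxx.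
pose x b := xchoose (hG b).
have xP b : vge v b (x b) /\ F b = gr_class b (x b).
  by have /andP[h /eqP] := xchooseP (hG b).
rewrite (proj2 (xP a)); apply/eqP; rewrite gr_class_eq0 ?(proj1 (xP a)) //.
have : gr_pi (\sum_(b <- s) rees_mon b (x b)) == 0.
  rewrite rmorph_sum; apply/eqP; rewrite -[RHS]s0; apply/eq_bigr => b _.
  by rewrite (proj2 (xP b)).
rewrite gr_pi_eq0 => /rees_idealP /(_ a).
rewrite rmorph_sum raddf_sum (big_fsetD1 a) //= big1_fset => [|b].
  by rewrite addr0 rees_monE ?(proj1 (xP a)) // mcoeffUU.
rewrite in_fsetD1 => /andP[ba _] _.
by rewrite rees_monE ?(proj1 (xP b)) // mcoeffU (negPf ba).
Qed.

Fact gr_unit a r : gr_hom a r -> r != 0 -> exists r', r * r' = 1.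
Proof.
move=> [x ax ->]; rewrite gr_class_eq0 // /vgt negb_or -ogle_leNgt.
case/andP=> x0 va; have xa : vge v (- a) x^-1.
  by rewrite /vge invr_eq0 (negPf x0) valV // -(ogle_add (a + v x)) addrK
    addrAC subrr add0r.
exists (gr_class (- a) x^-1).
by rewrite -gr_classM // subrr mulfV // gr_class1.
Qed.

Definition gr : gradedField G := GradedField gr_grading gr_unit.

End AssociatedGraded.

Definition val_extends (E K : fieldType) (phi : E -> K) (G D : ordGroupType)
    (j : G -> D) (v : valuation E G) (w : valuation K D) :=
  forall x, x != 0 -> w (phi x) = j (v x).

Section ExtensionMaps.
Variables (E K : fieldType) (phi : {rmorphism E -> K}) (G : ordGroupType).
Variables (v : valuation E G) (w : valuation K G).
Hypothesis h : val_extends phi id v w.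

Lemma vge_ext a x : vge w a (phi x) = vge v a x.
Proof. by rewrite /vge fmorph_eq0; case: eqVneq => //= /h->. Qed.

Lemma vgt_ext a x : vgt w a (phi x) = vgt v a x.
Proof. by rewrite /vgt fmorph_eq0; case: eqVneq => //= /h->. Qed.

Fact val_ring_ext_subproof (u : val_ring v) :
  phi (val u) \in val_ring_pred w.
Proof. by rewrite val_ringE vge_ext; exact: (valP u). Qed.

Definition val_ring_ext (u : val_ring v) : val_ring w :=
  ValRing (val_ring_ext_subproof u).

Definition residue_map (r : residue_field v) : residue_field w :=
  residue (val_ring_ext (res_repr r)).

Lemma residue_mapE u : residue_map (residue u) = residue (val_ring_ext u).
Proof.
apply/eqP; rewrite -subr_eq0 -rmorphB residue_eq0 rmorphB /= -rmorphB vgt_ext.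
by rewrite -(rmorphB (val : val_ring v -> E)) -residue_eq0 rmorphB /= res_reprK subrr.
Qed.

Fact residue_map_zmod : zmod_morphism residue_map.
Proof.
move=> r s; rewrite -[r]res_reprK -[s]res_reprK.
move: (res_repr r) (res_repr s) => x y.
rewrite -rmorphB !residue_mapE -rmorphB; congr residue; apply: val_inj.
by rewrite rmorphB /= rmorphB.
Qed.

Fact residue_map_monoid : monoid_morphism residue_map.
Proof.
split=> [|r s].
  rewrite -(rmorph1 (@residue _ _ v)) residue_mapE -(rmorph1 (@residue _ _ w)).
  by congr residue; apply: val_inj; rewrite /= !rmorph1.
rewrite -[r]res_reprK -[s]res_reprK.
move: (res_repr r) (res_repr s) => x y.
rewrite -rmorphM !residue_mapE -rmorphM; congr residue; apply: val_inj.
by rewrite rmorphM /= rmorphM.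
Qed.

HB.instance Definition _ := GRing.isZmodMorphism.Build
  (residue_field v) (residue_field w) residue_map residue_map_zmod.
HB.instance Definition _ := GRing.isMonoidMorphism.Build
  (residue_field v) (residue_field w) residue_map residue_map_monoid.

Fact rees_ext_subproof (f : rees v) : galg_map phi (val f) \in rees_pred w.
Proof.
by apply/reesP => a; rewrite galg_coef_map vge_ext; have /reesP := valP f.
Qed.

Definition rees_ext (f : rees v) : rees w := Rees (rees_ext_subproof f).

Definition gr_map (r : gr v) : gr w := gr_pi (rees_ext (gr_repr r)).

Lemma gr_mapE f : gr_map (gr_pi f) = gr_pi (rees_ext f).
Proof.
apply/eqP; rewrite -subr_eq0 -rmorphB gr_pi_eq0; apply/rees_idealP => a.
rewrite rmorphB /= -rmorphB galg_coef_map vgt_ext.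
rewrite -(rmorphB (val : rees v -> galg G E)); move: a; apply/rees_idealP.
by rewrite -gr_pi_eq0 rmorphB /= gr_reprK subrr.
Qed.

Fact gr_map_zmod : zmod_morphism gr_map.
Proof.
move=> r s; rewrite -[r]gr_reprK -[s]gr_reprK.
move: (gr_repr r) (gr_repr s) => x y.
rewrite -rmorphB !gr_mapE -rmorphB; congr gr_pi; apply: val_inj.
by rewrite rmorphB /= rmorphB.
Qed.

Fact gr_map_monoid : monoid_morphism gr_map.
Proof.
split=> [|r s].
  rewrite -(rmorph1 (@gr_pi _ _ v)) gr_mapE -(rmorph1 (@gr_pi _ _ w)).
  by congr gr_pi; apply: val_inj; rewrite /= !rmorph1.
rewrite -[r]gr_reprK -[s]gr_reprK.
move: (gr_repr r) (gr_repr s) => x y.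
rewrite -rmorphM !gr_mapE -rmorphM; congr gr_pi; apply: val_inj.
by rewrite rmorphM /= rmorphM.
Qed.

HB.instance Definition _ :=
  GRing.isZmodMorphism.Build (gr v) (gr w) gr_map gr_map_zmod.
HB.instance Definition _ :=
  GRing.isMonoidMorphism.Build (gr v) (gr w) gr_map gr_map_monoid.

Lemma gr_map_class a x : vge v a x ->
  gr_map (gr_class v a x) = gr_class w a (phi x).
Proof.
move=> ax; rewrite gr_mapE; congr gr_pi; apply: val_inj.
by rewrite /= [RHS]rees_monE ?vge_ext // -[val _]/(rees_val _) rees_monE // galg_mapU.
Qed.

End ExtensionMaps.

(* Extensions of v to K, with values in any ordered group containing G. *)
Record val_extension (E : fieldType) (G : ordGroupType) (v : valuation E G)
    (K : fieldExtType E) := ValExtension {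
  ext_group : ordGroupType;
  ext_emb : {additive G -> ext_group};
  ext_emb_mono : {mono ext_emb : a b / a <= b};
  ext_val :> valuation K ext_group;
  ext_valP : val_extends (in_alg K) ext_emb v ext_val
}.

(* v has a unique extension to every finite extension of E; valuations are
   identified when they have the same valuation ring. *)
Definition henselian (E : fieldType) (G : ordGroupType) (v : valuation E G) :=
  forall K : fieldExtType E, inhabited (val_extension v K) /\
    forall w w' : val_extension v K, vge w 0 =1 vge w' 0.

Definition free_of_rank (R S : comNzRingType) (phi : R -> S) (n : nat) :=
  exists b : 'I_n -> S,
    forall y, exists! c : {ffun 'I_n -> R}, y = \sum_i phi (c i) * b i.

Definition has_index (G : zmodType) (A B : G -> Prop) (m : nat) :=
  exists r : 'I_m -> G, (forall i, A (r i)) /\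
    forall a, A a -> exists! i, B (a - r i).

Definition defectless (E : fieldType) (G : ordGroupType) (v : valuation E G)
    (K : fieldExtType E) (w : valuation K G)
    (h : val_extends (in_alg K) id v w) :=
  exists f e, [/\ free_of_rank (residue_map h) f,
    has_index (value_group w) (value_group v) e & \dim {:K} = (f * e)%N].

(* An extension L of F is given by a graded morphism iota : F -> L, which is
   injective because nonzero homogeneous elements are invertible. *)
Definition graded_morphism (G : ordGroupType) (F L : gradedField G)
    (iota : F -> L) := forall a x, gf_hom a x -> gf_hom a (iota x).

Definition purely_wild (G : ordGroupType) (F L : gradedField G) (iota : F -> L)
    (p : nat) :=
  [/\ p \in [pchar F],
      forall x : L, gf_hom 0 x ->
        exists k, exists2 y : F, gf_hom 0 y & x ^+ (p ^ k) = iota y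
    & forall a, gf_supp L a -> exists k, gf_supp F (a *+ (p ^ k))].

Definition graded_isom (G : ordGroupType) (F L L' : gradedField G)
    (iota : F -> L) (iota' : F -> L') :=
  exists psi : {rmorphism L -> L'}, [/\ bijective psi,
    forall a x, gf_hom a x <-> gf_hom a (psi x)
    & forall x, psi (iota x) = iota' x].

(* Main.v *)
Require Import Defs.
From HB Require Import structures.
From mathcomp Require Import all_boot all_order all_algebra all_field.
From mathcomp Require Import finmap multinomials.monalg.
From mathcomp Require Import boolp.
Set Implicit Arguments.
Unset Strict Implicit.
Unset Printing Implicit Defensive.
Import Order.TTheory GRing.Theory Num.Theory.
Local Open Scope ring_scope.

(** Every homogeneous element x of L has a power x^(p^k) in the graded field
    F = gr v of E (purely_wild_power), and finitely many homogeneous elements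
    generate L over F. So L is reached from F by finitely many steps that adjoin
    a homogeneous p-th root, and it is enough to lift one such step: given an
    extension K of E, a valuation w of K and an embedding of gr w in L whose
    image contains x^p but not x, lift x^p to an element a of K and put
    K' = K(t) with t^p = a. If E has characteristic p this is a purely
    inseparable extension.

    The valuation of K' comes from L. Let g be the degree of x. To a polynomial
    f over K whose coefficients satisfy w (f_i) >= d - i g attach its symbol,
    the sum of the classes of the f_i in degree d - i g times x^i, an element of
    degree d of L. Symbols are multiplicative. Two facts make them define a
    valuation on K' whose associated graded field is the part of L generated by
    gr w and x:
    - a multiple of X^p - a has symbol 0, as x^p is the class of a
      (poly_symbol_dvd);
    - a nonzero polynomial of degree less than p has a nonzero symbol for a
      suitable d, since 1, x, ..., x^(p-1) are linearly independent over gr w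
      (graded_powers_free).
    As L is a domain (gf_mul_eq0), the same facts show that X^p - a is
    irreducible. The passage from symbols to a valuation is symbol_valuation,
    and the step as a whole is radical_extension.

    The degree p of K' over K is a residue degree or a ramification index
    according to whether g is a value of w, so each step is defectless
    (radical_defectless), and defectless extensions compose
    (defectless_trans). *)

(** * Homogeneous components in a graded field *)

Lemma seq_extremum (T : eqType) (e : rel T) (s : seq T) x0 :
  total e -> transitive e -> x0 \in s ->
  exists2 x, x \in s & forall y, y \in s -> e x y.
Proof.
move=> e_total e_trans; have e_refl : reflexive e.
  by move=> x; have := e_total x x; rewrite orbb.
elim: s x0 => // y [|z s] IH x0 _.
  by exists y; rewrite ?mem_seq1 // => t; rewrite mem_seq1 => /eqP->.
have [x xs xmin] := IH z (mem_head _ _).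
have /orP[xy|yx] := e_total x y.
  exists x => [|t]; rewrite in_cons; first by rewrite xs orbT.
  by case/orP=> [/eqP->|/xmin].
exists y => [|t]; rewrite in_cons ?eqxx //.
by case/orP=> [/eqP->|/xmin]; [|exact: e_trans].
Qed.

Lemma addr_eq_max (G : ordGroupType) (a b c d : G) :
  c <= a -> d <= b -> c + d = a + b -> c = a /\ d = b.
Proof.
move=> ca db e; have ac : c = a.
  apply/eqP; rewrite eq_le ca ogle_leNgt; apply/negP => lca.
  by have := oglt_leD lca db; rewrite e ltxx.
by split=> //; move: e; rewrite ac => /addrI.
Qed.

Section HomogeneousComponents.
Variables (G : ordGroupType) (F : gradedField G).
Implicit Types (a b c : G) (x y z : F).

Lemma gf_homD a x y : gf_hom a x -> gf_hom a y -> gf_hom a (x + y).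
Proof.
have gF := gf_grading F => hx hy; rewrite -[y]opprK -[- y]sub0r.
by apply: (homB gF) => //; apply: (homB gF) => //; exact: (hom0 gF).
Qed.

Lemma gf_hom_sum a I (r : seq I) (P : pred I) (f : I -> F) :
  (forall i, P i -> gf_hom a (f i)) -> gf_hom a (\sum_(i <- r | P i) f i).
Proof.
by move=> h; elim/big_ind: _ => //; [exact: (hom0 (gf_grading F)) | exact: gf_homD].
Qed.

Lemma gf_homX a x n : gf_hom a x -> gf_hom (a *+ n) (x ^+ n).
Proof.
have gF := gf_grading F => hx; elim: n => [|n IH]; first exact: (hom1 gF).
by rewrite mulrS exprS; exact: (homM gF).
Qed.

(** Only existence and uniqueness of homogeneous decompositions are given; one
    is chosen for each element to obtain a projection on each degree. *)
Definition homogeneous_decomposition x (sf : {fset G} * (G -> F)) :=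
  (forall a, gf_hom a (sf.2 a)) /\ x = \sum_(a <- sf.1) sf.2 a.

Lemma homogeneous_decompositionP x : exists sf, homogeneous_decomposition x sf.
Proof. by have [s [f hf]] := hom_span (gf_grading F) x; exists (s, f). Qed.

Definition hdec x := projT1 (cid (homogeneous_decompositionP x)).
Definition hsupp x := (hdec x).1.
Definition hcomp a x := if a \in hsupp x then (hdec x).2 a else 0.

Lemma hcomp_hom a x : gf_hom a (hcomp a x).
Proof.
rewrite /hcomp /hsupp /hdec; case: cid => -[s f] [/= hf _].
by case: ifP => _ //; exact: (hom0 (gf_grading F)).
Qed.

Lemma hcomp_out a x : a \notin hsupp x -> hcomp a x = 0.
Proof. by rewrite /hcomp => /negPf->. Qed.

Lemma sum_hcomp x : \sum_(a <- hsupp x) hcomp a x = x.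
Proof.
rewrite /hcomp /hsupp /hdec; case: cid => -[s f] [/= _ {1}->].
by rewrite big_seq [RHS]big_seq; apply: eq_bigr => a ->.
Qed.

Lemma hcomp_uniq (s : {fset G}) (f g : G -> F) :
  (forall a, gf_hom a (f a)) -> (forall a, gf_hom a (g a)) ->
  \sum_(a <- s) f a = \sum_(a <- s) g a -> forall a, a \in s -> f a = g a.
Proof.
have gF := gf_grading F => hf hg e a sa.
apply/eqP; rewrite -subr_eq0; apply/eqP.
apply: (hom_indep gF (s := s) (f := fun a => f a - g a)) => // [b|].
  exact: (homB gF).
by rewrite sumrB e subrr.
Qed.

Lemma sum_hcompW (s : {fset G}) x :
  (hsupp x `<=` s)%fset -> \sum_(a <- s) hcomp a x = x.
Proof.
move=> le; rewrite -[RHS]sum_hcomp; symmetry.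
by apply: big_fset_incl => // a _; exact: hcomp_out.
Qed.

Lemma hcompE (s : {fset G}) (f : G -> F) : (forall a, gf_hom a (f a)) ->
  forall a, hcomp a (\sum_(b <- s) f b) = if a \in s then f a else 0.
Proof.
move=> hf a; set x := \sum_(b <- s) f b.
pose g b := if b \in s then f b else 0.
have gF := gf_grading F.
have hg b : gf_hom b (g b) by rewrite /g; case: ifP => _ //; exact: (hom0 gF).
pose t := (a |` (s `|` hsupp x))%fset.
apply: (hcomp_uniq (s := t) (f := hcomp^~ x) (g := g)) => //.
- by move=> b; exact: hcomp_hom.
- rewrite sum_hcompW; last by rewrite /t fsubsetU // fsubsetUr orbT.
  rewrite /x (_ : \sum_(b <- s) f b = \sum_(b <- s) g b).
    apply: big_fset_incl; first by rewrite /t fsubsetU // fsubsetUl orbT.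
    by move=> b _ /negPf; rewrite /g => ->.
  by rewrite big_seq [RHS]big_seq; apply: eq_bigr => b; rewrite /g => ->.
- by rewrite /t !inE eqxx.
Qed.

Lemma hcomp_id a x : gf_hom a x -> hcomp a x = x.
Proof.
move=> hx; pose f b := if b == a then x else 0.
have hf b : gf_hom b (f b).
  by rewrite /f; case: eqVneq => [->|_] //; exact: (hom0 (gf_grading F)).
have := hcompE [fset a]%fset hf a.
by rewrite big_seq_fset1 /f eqxx inE eqxx.
Qed.

Lemma hcomp_other a b x : gf_hom a x -> b != a -> hcomp b x = 0.
Proof.
move=> hx ba; pose f b := if b == a then x else 0.
have hf c : gf_hom c (f c).
  by rewrite /f; case: eqVneq => [->|_] //; exact: (hom0 (gf_grading F)).
have := hcompE [fset a]%fset hf b.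
by rewrite big_seq_fset1 /f eqxx inE (negPf ba).
Qed.

Fact hcomp_zmod a : zmod_morphism (hcomp a).
Proof.
move=> x y; pose s := (a |` (hsupp x `|` hsupp y))%fset.
have sx : (hsupp x `<=` s)%fset by rewrite fsubsetU // fsubsetUl orbT.
have sy : (hsupp y `<=` s)%fset by rewrite fsubsetU // fsubsetUr orbT.
rewrite -{1}(sum_hcompW sx) -{1}(sum_hcompW sy) -sumrB hcompE.
  by rewrite !inE eqxx.
by move=> b; apply: (homB (gf_grading F)); exact: hcomp_hom.
Qed.
HB.instance Definition _ a :=
  GRing.isZmodMorphism.Build F F (hcomp a) (hcomp_zmod a).

Lemma hcomp_eq0 x : (forall a, hcomp a x = 0) -> x = 0.
Proof. by move=> h; rewrite -[x]sum_hcomp big1. Qed.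

Lemma hcomp_neq0 x : x != 0 -> exists a, hcomp a x != 0.
Proof.
move=> x0; apply: contrapT => h; move/eqP: x0; apply; apply: hcomp_eq0 => a.
by apply: contrapT => /eqP xa; apply: h; exists a.
Qed.

(** Multiplication by a homogeneous element only shifts degrees. *)
Lemma hcompMr a b x y : gf_hom b y -> hcomp (a + b) (x * y) = hcomp a x * y.
Proof.
move=> hy; rewrite -[in LHS](sum_hcomp x) mulr_suml raddf_sum /=.
have [sa|/[dup] sa /hcomp_out->] := boolP (a \in hsupp x).
  rewrite (big_fsetD1 a) //= [X in _ + X]big1_fset ?addr0 => [|c].
    by rewrite hcomp_id //; apply: (homM (gf_grading F)); first exact: hcomp_hom.
  rewrite in_fsetD1 => /andP[ca _] _.
  apply: (@hcomp_other (c + b)); last by rewrite (inj_eq (addIr b)) eq_sym.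
  by apply: (homM (gf_grading F)); first exact: hcomp_hom.
rewrite mul0r big_seq big1 // => c sc; apply: (@hcomp_other (c + b)).
  by apply: (homM (gf_grading F)); first exact: hcomp_hom.
by rewrite (inj_eq (addIr b)); apply: contraNneq sa => ->.
Qed.

Lemma gf_hom_unit a x : gf_hom a x -> x != 0 ->
  exists2 y, gf_hom (- a) y & x * y = 1.
Proof.
move=> hx x0; have [y xy] := gf_unit hx x0.
exists (hcomp (- a) y); first exact: hcomp_hom.
rewrite mulrC -(hcompMr _ _ hx) addNr mulrC xy hcomp_id //.
exact: (hom1 (gf_grading F)).
Qed.

Lemma gf_mulhI a x y : gf_hom a x -> x != 0 -> x * y = 0 -> y = 0.
Proof.
move=> hx x0 xy; have [z _ xz] := gf_hom_unit hx x0.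
by rewrite -[y]mul1r -xz mulrAC xy mul0r.
Qed.

Lemma hcomp_top x : x != 0 -> exists2 a, hcomp a x != 0 &
  forall b, hcomp b x != 0 -> b <= a.
Proof.
move=> x0; have [a0 xa0] := hcomp_neq0 x0.
have in_s b : hcomp b x != 0 -> b \in [seq b <- hsupp x | hcomp b x != 0].
  by move=> xb; rewrite mem_filter xb; apply: contraNT xb => /hcomp_out->.
have [|b c d bc db|a] := seq_extremum (e := fun b c => c <= b) _ _ (in_s _ xa0).
- by move=> b c; exact: ogle_total.
- exact: le_trans db bc.
by rewrite mem_filter => /andP[xa _] amax; exists a => // b /in_s /amax.
Qed.

(** In the product of the components of largest degree of x and of y nothing
    can cancel: by totality of the order no other pair of components reaches
    that degree, and nonzero homogeneous elements are units. *)
Lemma gf_mul_eq0 x y : x * y = 0 -> x = 0 \/ y = 0.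
Proof.
move=> xy; have [->|x0] := eqVneq x 0; first by left.
have [->|y0] := eqVneq y 0; [by right | exfalso].
have [a xa amax] := hcomp_top x0; have [b yb bmax] := hcomp_top y0.
have : hcomp (a + b) (x * y) = hcomp a x * hcomp b y.
  have sb : b \in hsupp y by apply: contraNT yb => /hcomp_out->.
  rewrite -{1}(sum_hcomp y) mulr_sumr raddf_sum /= (big_fsetD1 b) //=.
  rewrite hcompMr ?[X in _ + X]big1_fset ?addr0 //; last exact: hcomp_hom.
  move=> c; rewrite in_fsetD1 => /andP[cb _] _.
  have -> : a + b = (a + b - c) + c by rewrite subrK.
  rewrite hcompMr; last exact: hcomp_hom.
  have [->|xc] := eqVneq (hcomp (a + b - c) x) 0; first by rewrite mul0r.
  have [->|yc] := eqVneq (hcomp c y) 0; first by rewrite mulr0.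
  have [_ ecb] := addr_eq_max (amax _ xc) (bmax _ yc) (subrK _ _).
  by rewrite ecb eqxx in cb.
rewrite xy raddf0 => /esym /(gf_mulhI (hcomp_hom a x) xa) yb0.
by rewrite yb0 eqxx in yb.
Qed.

End HomogeneousComponents.

(** * Powers of a purely inseparable homogeneous element *)

Section PolynomialsOverDomains.
Variable R : comNzRingType.
Hypothesis domR : forall x y : R, x * y = 0 -> x = 0 \/ y = 0.

(** Unique factorization of a power of X - c: over a domain one of two factors
    has the root c, and X - c can be cancelled since it is monic. *)
Lemma monic_factor_XsubCX (c : R) n (f g : {poly R}) : f \is monic ->
  f * g = ('X - c%:P) ^+ n -> exists k, f = ('X - c%:P) ^+ k.
Proof.
elim: n f g => [|n IH] f g fm fg.
  exists 0; rewrite expr0 in fg *.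
  have g0 : g != 0 by apply: contra_eq_neq fg => ->; rewrite mulr0 eq_sym oner_eq0.
  have sf : size f = 1%N.
    have := size_monicM fm g0; rewrite fg size_poly1.
    have : (0 < size f)%N by rewrite size_poly_gt0 monic_neq0.
    have : (0 < size g)%N by rewrite size_poly_gt0.
    case: (size f) => // -[//|m]; case: (size g) => // k _ _.
    by rewrite addSn addnS.
  have /eqP/size_poly1P[a _ fa] := sf.
  by have /monicP := fm; rewrite fa lead_coefC => ->.
have fgc : f.[c] * g.[c] = 0.
  by rewrite -hornerM fg exprS hornerM hornerXsubC subrr mul0r.
have Xm := monicXsubC c.
case: (domR fgc) => /rootP/factor_theorem[q e].
  have [||k qk] := IH q g.
  - by move: fm; rewrite e monicMr.
  - apply: (monic_rreg Xm); rewrite -exprSr -fg e.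
    by rewrite -!mulrA [g * _]mulrC.
  by exists k.+1; rewrite e qk exprSr.
have [||k fk] := IH f q => //.
  by apply: (monic_rreg Xm); rewrite -exprSr -fg e mulrA.
by exists k.
Qed.

End PolynomialsOverDomains.

Lemma coefPn_XsubCX (R : comNzRingType) (c : R) k :
  (('X - c%:P) ^+ k.+1)`_k = - (c *+ k.+1).
Proof.
have := @coefPn_prod_XsubC R (nseq k.+1 c).
by rewrite size_nseq !big_nseq iter_mulr_1 iter_addr_0 => /(_ isT).
Qed.

Section GradedIndependence.
Variables (G : ordGroupType) (F L : gradedField G) (psi : {rmorphism F -> L}).
Hypothesis psi_graded : graded_morphism psi.

Lemma graded_morphism_comp a y : psi (hcomp a y) = hcomp a (psi y).
Proof.
rewrite -[in RHS](sum_hcomp y) rmorph_sum raddf_sum /=.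
have hp b : gf_hom b (psi (hcomp b y)) by apply/psi_graded/hcomp_hom.
have [sa|/[dup] sa /hcomp_out->] := boolP (a \in hsupp y).
  rewrite (big_fsetD1 a) //= [X in _ + X]big1_fset ?addr0 ?(hcomp_id (hp a)) // => b.
  by rewrite in_fsetD1 => /andP[ba _] _; rewrite (hcomp_other (hp b)) // eq_sym.
rewrite rmorph0 big_seq big1 // => b sb; rewrite (hcomp_other (hp b)) //.
by apply: contraNneq sa => ->.
Qed.

(** A nonzero element has a nonzero component, which is a unit. *)
Lemma graded_morphism_inj : injective psi.
Proof.
move=> y z /eqP; rewrite -subr_eq0 -rmorphB => /eqP e.
apply/eqP; rewrite -subr_eq0; apply/negPn/negP => yz0.
have [a yza] := hcomp_neq0 yz0.
have [t _ yt] := gf_hom_unit (hcomp_hom a _) yza.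
have := congr1 psi yt; rewrite rmorphM graded_morphism_comp e raddf0 mul0r rmorph1.
by move/esym/eqP; rewrite oner_eq0.
Qed.

Variables (p : nat) (x : L) (g : G).
Hypotheses (pF : p \in [pchar F]) (hx : gf_hom g x).

(** The relation f(x) = 0 splits into relations with homogeneous terms; in one
    of them the leading coefficient is nonzero, hence a unit. *)
Lemma monic_relation (f : {poly F}) : f != 0 -> (map_poly psi f).[x] = 0 ->
  exists2 h : {poly F}, h \is monic & size h = size f /\ (map_poly psi h).[x] = 0.
Proof.
move=> f0 fx; have [e sf] : exists e, size f = e.+1.
  by exists (size f).-1; rewrite prednK // size_poly_gt0.
have : f`_e != 0 by move: f0; rewrite -lead_coef_eq0 lead_coefE sf.
case/hcomp_neq0 => d fe0; have [c _ fec] := gf_hom_unit (hcomp_hom d _) fe0.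
pose h := \poly_(i < e.+1) (c * hcomp (d + g *+ e - g *+ i) f`_i).
have he : h`_e = 1 by rewrite coef_poly ltnSn addrK mulrC.
have sh : size h = e.+1 by rewrite size_poly_eq //= addrK mulrC fec oner_eq0.
exists h; first by rewrite monicE lead_coefE sh /= he.
split; first by rewrite sf.
rewrite (@horner_coef_wide _ e.+1) ?(leq_trans (size_poly _ _)) ?sh //.
rewrite (eq_bigr (fun i : 'I_e.+1 =>
  psi c * hcomp (d + g *+ e) (psi f`_i * x ^+ i))) => [|i _].
  rewrite -mulr_sumr -raddf_sum /=.
  have := @horner_coef_wide _ e.+1 (map_poly psi f) x.
  rewrite fx (leq_trans (size_poly _ _)) ?sf // => /(_ isT) e0.
  rewrite (_ : \sum_(i < _) _ = 0) ?raddf0 ?mulr0 // [RHS]e0.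
  by apply: eq_bigr => i _; rewrite coef_map.
rewrite coef_map coef_poly ltn_ord.
transitivity (psi c * psi (hcomp (d + g *+ e - g *+ i) f`_i) * x ^+ i).
  by congr (_ * _); exact: (rmorphM psi).
by rewrite -mulrA graded_morphism_comp -(hcompMr _ _ (gf_homX i hx)) subrK.
Qed.

(** A purely inseparable element of height one has degree p, as for fields.
    A monic polynomial over F of minimal degree k among those that vanish at x
    divides X^p - x^p = (X - x)^p, hence equals (X - x)^k over the domain L.
    Its coefficient of degree k - 1 is - k x, so x lies in F unless p divides
    k. By monic_relation, k is also the minimal degree of all nonzero
    polynomials over F that vanish at x. *)
Lemma graded_powers_free (b : F) : x ^+ p = psi b ->
  ~ (exists y, psi y = x) ->
  forall f : {poly F}, (size f <= p)%N -> (map_poly psi f).[x] = 0 -> f = 0.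
Proof.
move=> xp x_notin f sf fx; apply/eqP/negPn/negP => f0.
have p_pr := pcharf_prime pF; have p_gt0 := prime_gt0 p_pr.
pose P (n : nat) := `[< exists2 h : {poly F}, h \is monic &
  size h = n /\ (map_poly psi h).[x] = 0 >].
have exP : exists n, P n.
  have [h hm hfx] := monic_relation f0 fx; exists (size f).
  by apply/asboolP; exists h.
pose n := ex_minn exP; have /asboolP[h hm [sh hx0]] : P n.
  by rewrite /n; case: ex_minnP.
have nmin m : P m -> (n <= m)%N by rewrite /n; case: ex_minnP => ? _; apply.
have np : (n <= p)%N.
  have [h' hm' [sh' hx']] := monic_relation f0 fx.
  by apply: leq_trans sf; apply: nmin; apply/asboolP; exists h'.
have pL : p \in [pchar {poly L}] by rewrite pchar_poly; exact: rmorph_pchar pF.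
have XpE : map_poly psi ('X^p - b%:P) = ('X - x%:P) ^+ p.
  rewrite rmorphB /= map_polyXn map_polyC /= -xp.
  rewrite exprDn_pchar ?exprNn_pchar ?polyC_exp //;
    by rewrite ?pnatE //; exact: pnat_id.
have h0 : h != 0 by exact: monic_neq0.
(* The remainder of a division by h vanishes at x, so it is zero. *)
have [q qE] : exists q, 'X^p - b%:P = q * h.
  exists (Pdiv.Ring.rdivp ('X^p - b%:P) h).
  have E := Pdiv.RingMonic.rdivp_eq hm ('X^p - b%:P).
  rewrite {1}E; set r := Pdiv.Ring.rmodp _ _ in E *.
  suff -> : r = 0 by rewrite addr0.
  apply/eqP/negPn/negP => r0; have rx : (map_poly psi r).[x] = 0.
    have := congr1 (fun P => (map_poly psi P).[x]) E.
    rewrite XpE rmorphD rmorphM /= hornerD hornerM hx0 mulr0 add0r => <-.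
    by rewrite -(prednK p_gt0) exprS hornerM hornerXsubC subrr mul0r.
  have [k km [sk kx]] := monic_relation r0 rx.
  have : (size r < n)%N by rewrite -sh Pdiv.Ring.ltn_rmodpN0.
  by rewrite ltnNge nmin //; apply/asboolP; exists k.
have [|k hk] := @monic_factor_XsubCX L (@gf_mul_eq0 _ L) x p
    (map_poly psi h) (map_poly psi q) (monic_map psi hm).
  by rewrite -XpE qE rmorphM mulrC.
have kn : n = k.+1.
  have := congr1 (fun P : {poly L} => size P) hk; rewrite size_exp_XsubC => <-.
  by rewrite size_map_poly_id0 ?sh // (monicP hm) rmorph1 oner_eq0.
have [k0|k_gt0] := posnP k.
  by move: hx0; rewrite hk k0 expr0 hornerC => /eqP; rewrite oner_eq0.
(* Since 0 < k < p, the integer k is invertible in F. *)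
have [u uk] : exists u, (u * k)%:R = 1 :> F.
  have cop : coprime k p.
    rewrite coprime_sym prime_coprime // gtnNdvd //.
    by rewrite -kn.
  exists (egcdn k p).1; have := egcdnP p k_gt0; case: egcdnP => //= km kp e _ _.
  by rewrite e (eqP cop) natrD natrM (pcharf0 pF) mulr0 add0r.
apply: x_notin; exists (- h`_k.-1 *+ u); rewrite rmorphMn rmorphN.
have := congr1 (fun P : {poly L} => P`_k.-1) hk.
rewrite coef_map -{2}(prednK k_gt0) coefPn_XsubCX prednK // => ->.
by rewrite opprK -mulrnA mulnC -mulr_natr -(rmorph_nat psi) uk rmorph1 mulr1.
Qed.

End GradedIndependence.

(** * Valuations from principal symbols *)

Section GradedLift.
Variables (E : fieldType) (G : ordGroupType) (v : valuation E G).

Lemma rees_sum_mon (f : rees v) :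
  f = \sum_(a <- msupp (val f)) rees_mon v a ((val f)@_a).
Proof.
apply: val_inj; rewrite rmorph_sum [LHS]galgE; apply: eq_bigr => a _ /=.
by rewrite rees_monE //; have /reesP := valP f.
Qed.

Lemma gr_homP a (r : gr v) : gf_hom a r ->
  exists2 x, vge v a x & r = gr_class v a x.
Proof. by []. Qed.

Lemma gr_class_hom a x : vge v a x -> gf_hom a (gr_class v a x : gr v).
Proof. by exists x. Qed.

Variables (R : comNzRingType) (s : G -> E -> R).
Hypothesis sB : forall a x y, vge v a x -> vge v a y ->
  s a (x - y) = s a x - s a y.
Hypothesis s_vgt : forall a x, vgt v a x -> s a x = 0.
Hypothesis s1 : s 0 1 = 1.
Hypothesis sM : forall a b x y, vge v a x -> vge v b y ->
  s (a + b) (x * y) = s a x * s b y.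

Let s0 a : s a 0 = 0. Proof. exact/s_vgt/vgt0. Qed.

Let lift_rees (f : rees v) := \sum_(a <- msupp (val f)) s a ((val f)@_a).

Let lift_reesW (d : {fset G}) f : (msupp (val f) `<=` d)%fset ->
  lift_rees f = \sum_(a <- d) s a ((val f)@_a).
Proof.
by move=> le; apply: big_fset_incl => // a _ /mcoeff_outdom ->; rewrite s0.
Qed.

Let lift_rees_zmod : zmod_morphism lift_rees.
Proof.
move=> f g; have /reesP hf := valP f; have /reesP hg := valP g.
pose d := (msupp (val (f - g)) `|` (msupp (val f) `|` msupp (val g)))%fset.
rewrite (@lift_reesW d (f - g)) ?fsubsetUl // (@lift_reesW d f); last first.
  by rewrite fsubsetU // fsubsetUl orbT.
rewrite (@lift_reesW d g); last by rewrite fsubsetU // fsubsetUr orbT.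
rewrite -sumrB; apply: eq_bigr => a _.
by rewrite (raddfB (val : rees v -> galg G E)) mcoeffB sB.
Qed.
HB.instance Definition _ :=
  GRing.isZmodMorphism.Build (rees v) R lift_rees lift_rees_zmod.

Let lift_rees_mon a x : vge v a x -> lift_rees (rees_mon v a x) = s a x.
Proof.
move=> ax; rewrite (@lift_reesW [fset a]%fset) /=; last first.
  by rewrite rees_monE // msuppU_le.
by rewrite big_seq_fset1 rees_monE // mcoeffUU.
Qed.

Let lift_rees_monoid : monoid_morphism lift_rees.
Proof.
split=> [|f g].
  rewrite -s1 -lift_rees_mon ?vge01 //; congr lift_rees; apply: val_inj.
  by rewrite /= rees_monE ?vge01 // rmorph1.
have /reesP hf := valP f; have /reesP hg := valP g.
rewrite [f]rees_sum_mon [g]rees_sum_mon mulr_suml !raddf_sum [RHS]mulr_suml /=.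
apply: eq_bigr => a _; rewrite mulr_sumr !raddf_sum [RHS]mulr_sumr /=.
apply: eq_bigr => b _; rewrite !lift_rees_mon // -sM // -lift_rees_mon ?vgeM //.
congr lift_rees; apply: val_inj.
by rewrite rmorphM /= !rees_monE ?vgeM // galgUM.
Qed.

(** The universal property of gr v: a family of maps that respects sums and
    products and kills elements of larger value factors through it. *)
Lemma gr_lift : exists psi : {rmorphism gr v -> R},
  forall a x, vge v a x -> psi (gr_class v a x) = s a x.
Proof.
pose psi (r : gr v) := lift_rees (gr_repr r).
have psiE f : psi (gr_pi f) = lift_rees f.
  apply/eqP; rewrite -subr_eq0 -raddfB; apply/eqP.
  have : gr_repr (gr_pi f) - f \in @rees_ideal _ _ v.
    by rewrite -gr_pi_eq0 rmorphB /= gr_reprK subrr.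
  by move/rees_idealP => h; apply: big1 => a _; exact: s_vgt.
have psi_zmod : zmod_morphism psi.
  move=> r t; rewrite -[r]gr_reprK -[t]gr_reprK.
  by rewrite -rmorphB !psiE raddfB.
have psi_monoid : monoid_morphism psi.
  split=> [|r t].
    by rewrite -(rmorph1 (@gr_pi _ _ v)) psiE; case: lift_rees_monoid.
  rewrite -[r]gr_reprK -[t]gr_reprK -rmorphM !psiE.
  by case: lift_rees_monoid => _ ->.
pose A := GRing.isZmodMorphism.Build _ _ psi psi_zmod.
pose B := GRing.isMonoidMorphism.Build _ _ psi psi_monoid.
pose psi' : {rmorphism gr v -> R} := HB.pack psi A B.
exists psi' => a x ax; rewrite -lift_rees_mon //; exact: psiE.
Qed.

End GradedLift.

Lemma gr_morphism_eq (E : fieldType) (G : ordGroupType) (v : valuation E G)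
    (R : comNzRingType) (f g : {rmorphism gr v -> R}) :
  (forall a x, vge v a x -> f (gr_class v a x) = g (gr_class v a x)) -> f =1 g.
Proof.
move=> fg r; rewrite -[r]gr_reprK gr_piE.
rewrite (rmorph_sum f) (rmorph_sum g); apply: eq_bigr => a _; apply: fg.
by have /reesP := valP (gr_repr r).
Qed.

(** S a z l reads: z lies in the a-th step of a filtration of K and has
    principal symbol l there. Through symbol_fun, l is a function of a and
    z; through symbol_lt and symbol_ex, every nonzero z has an exact level. *)
Record symbol_relation (K : fieldType) (G : ordGroupType) (L : gradedField G)
    (S : G -> K -> L -> Prop) : Prop := SymbolRelation {
  symbol_hom : forall a z l, S a z l -> gf_hom a l;
  symbol0 : forall a, S a 0 0;
  symbolB : forall a y z l m, S a y l -> S a z m -> S a (y - z) (l - m);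
  symbol1 : S 0 1 1;
  symbolM : forall a b y z l m, S a y l -> S b z m -> S (a + b) (y * z) (l * m);
  symbol_fun : forall a l, S a 0 l -> l = 0;
  symbol_lt : forall a b z l, a < b -> S b z l -> S a z 0;
  symbol_ex : forall z, z != 0 -> exists a, exists2 l, l != 0 & S a z l
}.

Section SymbolRelationTheory.
Variables (K : fieldType) (G : ordGroupType) (L : gradedField G).
Variable S : G -> K -> L -> Prop.
Hypothesis hS : symbol_relation S.

Lemma symbolD a y z l m : S a y l -> S a z m -> S a (y + z) (l + m).
Proof.
move=> Sy Sz; rewrite -[z]opprK -[m]opprK.
apply: (symbolB hS) => //; rewrite -[- z]sub0r -[- m]sub0r.
by apply: (symbolB hS) => //; exact: (symbol0 hS).
Qed.

Lemma symbol_sum a I (r : seq I) (P : pred I) (f : I -> K) (g : I -> L) :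
  (forall i, P i -> S a (f i) (g i)) ->
  S a (\sum_(i <- r | P i) f i) (\sum_(i <- r | P i) g i).
Proof.
move=> h; elim/big_ind2: _ => //; first exact: (symbol0 hS).
by move=> *; exact: symbolD.
Qed.

Lemma symbol_inj a z l m : S a z l -> S a z m -> l = m.
Proof.
move=> Sl Sm; apply/eqP; rewrite -subr_eq0; apply/eqP.
by apply: (symbol_fun hS (a := a)); rewrite -(subrr z); exact: (symbolB hS).
Qed.

(** Below the level of a nonzero symbol all symbols are zero. *)
Lemma symbol_level a b z l m :
  l != 0 -> S a z l -> m != 0 -> S b z m -> a = b.
Proof.
have aux c d y k n : k != 0 -> S c y k -> S d y n -> d <= c.
  move=> k0 Sk Sn; rewrite ogle_leNgt; apply: contraNN k0 => cd.
  by rewrite (symbol_inj Sk (symbol_lt hS cd Sn)).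
by move=> l0 Sl m0 Sm; apply/eqP; rewrite eq_le (aux b a z m l) ?(aux a b z l m).
Qed.

(** The value of z is the level at which its symbol is nonzero. This is
    multiplicative because the product of two nonzero homogeneous elements of L
    is nonzero, and z |-> l then embeds the associated graded field in L. *)
Lemma symbol_valuation : exists (w : valuation K G) (psi : {rmorphism gr w -> L}),
  graded_morphism psi /\
  forall a z l, S a z l <-> vge w a z /\ psi (gr_class w a z) = l.
Proof.
have /choice[w0 w0P] : forall z, exists a, z != 0 -> exists2 l, l != 0 & S a z l.
  move=> z.
  have [->|/(symbol_ex hS)[a [l l0 Sl]]] := eqVneq z 0; first by exists 0.
  by exists a => _; exists l.
have w0_uniq a z l : l != 0 -> S a z l -> w0 z = a.
  move=> l0 Sl; have [z0|z0] := eqVneq z 0.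
    by move: l0; rewrite z0 in Sl; rewrite (symbol_fun hS Sl) eqxx.
  by have [m m0 Sm] := w0P z z0; exact: (symbol_level m0 Sm l0 Sl).
have w0M y z : y != 0 -> z != 0 -> w0 (y * z) = w0 y + w0 z.
  move=> /w0P[l l0 Sl] /w0P[m m0 Sm].
  apply: (w0_uniq _ _ (l * m)); last exact: (symbolM hS).
  apply: contraNneq m0 => lm.
  by rewrite (gf_mulhI (symbol_hom hS Sl) l0 lm).
have w0_lt a z : z != 0 -> a < w0 z -> S a z 0.
  by move=> /w0P[l _ Sl] az; exact: (symbol_lt hS az Sl).
have w0D y z : y != 0 -> z != 0 -> y + z != 0 ->
    Num.min (w0 y) (w0 z) <= w0 (y + z).
  move=> y0 z0 /w0P[m m0 Sm]; rewrite ogle_leNgt; apply: contraNN m0 => lt_m.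
  have /andP[ly lz] : (w0 (y + z) < w0 y) && (w0 (y + z) < w0 z).
    move: lt_m; rewrite /Order.min; case: ifPn => [yz lt|].
      by rewrite lt (lt_trans lt yz).
    by rewrite -ogle_leNgt => zy lt; rewrite (lt_le_trans lt zy).
  by rewrite (symbol_inj Sm (symbolD (w0_lt _ _ y0 ly) (w0_lt _ _ z0 lz))) addr0.
pose w := Valuation w0M w0D.
have vgeP a z : vge w a z -> exists l, S a z l.
  have [->|z0] := eqVneq z 0; first by exists 0; exact: (symbol0 hS).
  rewrite /vge (negPf z0) le_eqVlt /= => /orP[/eqP->|az].
    by have [l _ Sl] := w0P z z0; exists l.
  by exists 0; exact: w0_lt.
have Sge a z l : S a z l -> vge w a z.
  move=> Sl; rewrite /vge; have [//|/= z0] := eqVneq z 0.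
  rewrite ogle_leNgt; have [m m0 Sm] := w0P z z0; apply: contraNN m0 => lt_a.
  by rewrite (symbol_inj Sm (symbol_lt hS lt_a Sl)).
have vgt_S a z : vgt w a z -> S a z 0.
  have [->|z0] := eqVneq z 0; first by move=> _; exact: (symbol0 hS).
  by rewrite /vgt (negPf z0) => az; exact: w0_lt.
have /choice[s sP] : forall az : G * K, exists l,
    vge w az.1 az.2 -> S az.1 az.2 l.
  move=> az.
  have [/vgeP[l Sl]|_] := boolP (vge w az.1 az.2); [by exists l | by exists 0].
have sE a z l : S a z l -> s (a, z) = l.
  by move=> Sl; exact: (symbol_inj (sP (a, z) (Sge _ _ _ Sl)) Sl).
have [|||| psi psiE] := @gr_lift K G w L (fun a z => s (a, z)).
- move=> a y z ay az; apply: sE.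
  by apply: (symbolB hS); [exact: (sP (a, y)) | exact: (sP (a, z))].
- by move=> a z az; apply: sE; exact: vgt_S.
- by apply: sE; exact: (symbol1 hS).
- move=> a b y z ay bz; apply: sE.
  by apply: (symbolM hS); [exact: (sP (a, y)) | exact: (sP (b, z))].
exists w, psi; split.
  move=> a r /gr_homP[z az ->]; rewrite psiE //.
  exact: (symbol_hom hS (sP (a, z) az)).
move=> a z l; split=> [Sl|[az <-]]; last by rewrite psiE //; exact: (sP (a, z)).
by split; [exact: Sge Sl | rewrite psiE ?(Sge _ _ _ Sl) //; exact: sE].
Qed.

End SymbolRelationTheory.

Section SymbolOfValuation.
Variables (K : fieldType) (G : ordGroupType) (w : valuation K G).
Variables (L : gradedField G) (psi : {rmorphism gr w -> L}).
Hypothesis psi_graded : graded_morphism psi.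

Definition val_symbol a z l := vge w a z /\ psi (gr_class w a z) = l.

(** The converse of symbol_valuation: a graded morphism out of an associated
    graded field is injective, so it does not lose any symbol. *)
Lemma val_symbol_relation : symbol_relation val_symbol.
Proof.
split.
- by move=> a z l [az <-]; apply/psi_graded/gr_class_hom.
- by move=> a; split; rewrite ?vge0 // gr_class0 rmorph0.
- move=> a y z l m [ay <-] [az <-]; split; first by rewrite vgeD ?vgeN.
  by rewrite gr_classB // rmorphB.
- by split; rewrite ?vge01 // gr_class1 rmorph1.
- move=> a b y z l m [ay <-] [bz <-]; split; first exact: vgeM.
  by rewrite gr_classM // rmorphM.
- by move=> a l [_ <-]; rewrite gr_class0 rmorph0.
- move=> a b z l ab [bz _]; have az : vgt w a z.
    by case/orP: bz => [/eqP->|bz]; rewrite ?vgt0 // /vgt (lt_le_trans ab bz) orbT.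
  split; first exact: vgtW.
  by apply/eqP; rewrite (_ : gr_class _ _ _ = 0) ?rmorph0 //;
    apply/eqP; rewrite gr_class_eq0 // vgtW.
move=> z z0; have zz : vge w (w z) z by rewrite /vge lexx orbT.
exists (w z), (psi (gr_class w (w z) z)); last by split.
rewrite -(rmorph0 psi) (inj_eq (graded_morphism_inj psi_graded)) gr_class_eq0 //.
by rewrite /vgt (negPf z0) ltxx.
Qed.

Lemma gr_morph_class_eq0 a z : vge w a z ->
  (psi (gr_class w a z) == 0) = vgt w a z.
Proof.
by move=> az; rewrite -(rmorph0 psi) (inj_eq (graded_morphism_inj psi_graded))
  gr_class_eq0.
Qed.

End SymbolOfValuation.

(** * Symbols of polynomials modulo X^p - a *)

Section PolynomialSymbols.
Variables (K : fieldType) (G : ordGroupType) (L : gradedField G).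
Variable S : G -> K -> L -> Prop.
Hypothesis hS : symbol_relation S.
Variables (x : L) (g : G).
Hypothesis hx : gf_hom g x.
Implicit Types (d : G) (f : {poly K}) (h : {poly L}).

(** The symbol of the polynomial f for the Gauss extension in which the
    variable has value g, before evaluation at x. *)
Definition poly_symbol d f h := forall i, S (d - g *+ i) f`_i h`_i.

Lemma poly_symbol0 d : poly_symbol d 0 0.
Proof. by move=> i; rewrite !coef0; exact: (symbol0 hS). Qed.

Lemma poly_symbolB d f1 f2 h1 h2 : poly_symbol d f1 h1 -> poly_symbol d f2 h2 ->
  poly_symbol d (f1 - f2) (h1 - h2).
Proof. by move=> H1 H2 i; rewrite !coefB; exact: (symbolB hS). Qed.

Lemma poly_symbolC d c l : S d c l -> poly_symbol d c%:P l%:P.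
Proof.
move=> Sc i; rewrite !coefC; case: eqP => [->|_]; last exact: (symbol0 hS).
by rewrite mulr0n subr0.
Qed.

Lemma poly_symbolX : poly_symbol g 'X 'X.
Proof.
move=> i; rewrite !coefX; case: eqP => [->|_]; last exact: (symbol0 hS).
by rewrite mulr1n subrr; exact: (symbol1 hS).
Qed.

Lemma poly_symbolM d e f1 f2 h1 h2 :
  poly_symbol d f1 h1 -> poly_symbol e f2 h2 ->
  poly_symbol (d + e) (f1 * f2) (h1 * h2).
Proof.
move=> H1 H2 i; rewrite !coefM; apply: symbol_sum => // j _.
have -> : d + e - g *+ i = (d - g *+ j) + (e - g *+ (i - j)).
  have ji : (j <= i)%N by rewrite -ltnS.
  by rewrite addrACA -opprD -mulrnDr subnKC.
exact: (symbolM hS).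
Qed.

Lemma poly_symbol_lt d e f h : d < e -> poly_symbol e f h -> poly_symbol d f 0.
Proof.
move=> de H i; rewrite coef0; apply: (symbol_lt hS _ (H i)).
by rewrite ![_ - _]addrC oglt_add.
Qed.

Lemma poly_symbol_fun d h : poly_symbol d 0 h -> h = 0.
Proof.
move=> H; apply/polyP => i; rewrite coef0.
by apply: (symbol_fun hS (a := d - g *+ i)); have := H i; rewrite coef0.
Qed.

Lemma poly_symbol_hom d f h : poly_symbol d f h -> gf_hom d h.[x].
Proof.
move=> H; rewrite horner_coef; apply: gf_hom_sum => i _.
have := homM (gf_grading L) (symbol_hom hS (H i)) (gf_homX i hx).
by rewrite subrK.
Qed.

Variables (p : nat) (a : K).
Hypotheses (p_gt0 : (0 < p)%N) (Sa : S (g *+ p) a (x ^+ p)).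

Let P : {poly K} := 'X^p - a%:P.

(** Rewriting X^p to a, and correspondingly to x^p on symbols, does not change
    the value of the symbol at x. *)
Lemma poly_symbol_reduce d f h : poly_symbol d f h ->
  exists f' h', [/\ (size f' <= p)%N, poly_symbol d f' h', P %| f - f'
    & h'.[x] = h.[x]].
Proof.
have [n] := ubnP (size f); elim: n f h => // n IH f h; rewrite ltnS => fn H.
have [fp|pf] := leqP (size f) p.
  by exists f, h; rewrite subrr dvdp0.
pose f1 := take_poly p f + a *: drop_poly p f.
pose h1 := take_poly p h + x ^+ p *: drop_poly p h.
have H1 : poly_symbol d f1 h1.
  move=> i; rewrite !coefD !coefZ !coef_take_poly !coef_drop_poly.
  apply: symbolD => //; first by case: ifP => _ //; exact: (symbol0 hS).
  have -> : d - g *+ i = g *+ p + (d - g *+ (i + p)).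
    by rewrite mulrnDr opprD addrCA (addrC (- (g *+ i))) addNKr.
  exact: (symbolM hS).
have sf1 : (size f1 < n)%N.
  apply: leq_trans fn; apply: leq_ltn_trans (size_polyD _ _) _.
  rewrite gtn_max (leq_ltn_trans (size_take_poly _ _) pf) /=.
  apply: leq_ltn_trans (size_scale_leq _ _) _.
  by rewrite size_drop_poly ltn_subrL p_gt0 (leq_ltn_trans _ pf).
have [f' [h' [sf' H' Pf' hx']]] := IH f1 h1 sf1 H1.
exists f', h'; split=> //.
  have -> : f - f' = (f - f1) + (f1 - f') by rewrite subrKA.
  apply: dvdp_add => //; rewrite -[X in X - f1](poly_take_drop p f) /f1.
  rewrite opprD addrACA subrr add0r -mul_polyC [_ * 'X^p]mulrC -mulrBl.
  exact: dvdp_mulr.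
rewrite hx' /h1 -[in RHS](poly_take_drop p h) !hornerE.
by rewrite mulrC.
Qed.

Lemma size_radical_poly : size P = p.+1.
Proof. by rewrite size_XnsubC. Qed.

Lemma poly_symbol_dvd d f h : P %| f -> poly_symbol d f h -> h.[x] = 0.
Proof.
move=> Pf /poly_symbol_reduce[f' [h' [sf' H' Pf' <-]]].
have {Pf'}Pf' : P %| f' by rewrite -(dvdp_subr f' Pf).
have f'0 : f' = 0.
  apply/eqP/negPn/negP => /dvdp_leq /(_ Pf').
  by rewrite size_radical_poly leqNgt ltnS sf'.
by rewrite f'0 in H'; rewrite (poly_symbol_fun H') horner0.
Qed.

Hypothesis poly_symbol_ex : forall f, f != 0 -> (size f <= p)%N ->
  exists d h, poly_symbol d f h /\ h.[x] != 0.

(** The symbols of two proper factors would be zero divisors in the domain L: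
    their product is a symbol of P, and its value at x is 0. *)
Lemma radical_poly_irreducible : (1 < p)%N -> irreducible_poly P.
Proof.
move=> p_gt1; split=> [|q q1 qP]; first by rewrite size_radical_poly ltnS.
have P0 : P != 0 by rewrite -size_poly_gt0 size_radical_poly.
rewrite -dvdp_size_eqp // size_radical_poly eqn_leq -size_radical_poly.
rewrite dvdp_leq //= size_radical_poly ltnNge; apply/negP => qp.
have /dvdpP[r rq] := qP.
have q0 : q != 0 by apply: contraNneq P0 => q0; rewrite rq q0 mulr0.
have r0 : r != 0 by apply: contraNneq P0 => r0; rewrite rq r0 mul0r.
have rp : (size r <= p)%N.
  have := size_mul r0 q0; rewrite -rq size_radical_poly.
  move: q1 q0; rewrite -size_poly_gt0; case: (size q) => [|[|m]] // _ _.
  by rewrite !addnS /= => -[->]; rewrite leq_addr.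
have [d [h [H hx0]]] := poly_symbol_ex q0 qp.
have [e [k [Hk kx0]]] := poly_symbol_ex r0 rp.
have := poly_symbolM Hk H; rewrite -rq => /(poly_symbol_dvd (dvdpp _)).
rewrite hornerM => /gf_mul_eq0[] /eqP; first exact/negP.
exact/negP.
Qed.

Variables (K' : fieldExtType K) (t : K').
Hypotheses (t_root : root (map_poly (in_alg K') P) t)
  (t_gen : <<1; t>>%VS = fullv) (P_irr : irreducible_poly P).

Lemma radical_root_dvd f : (map_poly (in_alg K') f).[t] = 0 -> P %| f.
Proof.
move=> ft; have [Pf1|/P_irr.2 e] := eqVneq (size (gcdp P f)) 1%N.
  have : coprimep (map_poly (in_alg K') P) (map_poly (in_alg K') f).
    by rewrite coprimep_map /coprimep Pf1.
  by move/coprimep_root => /(_ _ t_root); rewrite ft eqxx.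
by rewrite -(eqp_dvdl _ (e (dvdp_gcdl _ _))) dvdp_gcdr.
Qed.

(** The symbol of an element of K(t) is computed on any polynomial expression
    in t, of whatever degree; this makes products immediate and moves all the
    work to well-definedness. *)
Definition radical_symbol d (z : K') (l : L) := exists f h,
  [/\ poly_symbol d f h, z = (map_poly (in_alg K') f).[t] & l = h.[x]].

Lemma radical_symbolC d c l : S d c l -> radical_symbol d c%:A l.
Proof.
move=> Sc; exists c%:P, l%:P; split; first exact: poly_symbolC.
  by rewrite map_polyC hornerC.
by rewrite hornerC.
Qed.

(** The symbol is well defined because polynomials that vanish at t are
    multiples of P; it is somewhere nonzero because polynomials of degree less
    than p represent all elements. *)
Lemma radical_symbol_relation : symbol_relation radical_symbol.
Proof.
split.
- by move=> d z l [f [h [H _ ->]]]; exact: poly_symbol_hom H.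
- move=> d; exists 0, 0; split; first exact: poly_symbol0.
    by rewrite rmorph0 horner0.
  by rewrite horner0.
- move=> d y z l m [f1 [h1 [H1 -> ->]]] [f2 [h2 [H2 -> ->]]].
  exists (f1 - f2), (h1 - h2); split; first exact: poly_symbolB.
    by rewrite rmorphB hornerD hornerN.
  by rewrite hornerD hornerN.
- by have := radical_symbolC (symbol1 hS); rewrite scale1r.
- move=> d e y z l m [f1 [h1 [H1 -> ->]]] [f2 [h2 [H2 -> ->]]].
  exists (f1 * f2), (h1 * h2); split; first exact: poly_symbolM.
    by rewrite rmorphM hornerM.
  by rewrite hornerM.
- move=> d l [f [h [H /esym /radical_root_dvd Pf ->]]].
  exact: poly_symbol_dvd H.
- move=> d e z l de [f [h [H -> _]]]; exists f, 0; split=> //.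
    exact: poly_symbol_lt H.
  by rewrite horner0.
move=> z z0; have /Fadjoin1_polyP[f zf] : z \in <<1; t>>%VS.
  by rewrite t_gen memvf.
have zr : z = (map_poly (in_alg K') (f %% P)).[t].
  rewrite zf {1}(divp_eq f P) rmorphD rmorphM hornerD hornerM (rootP t_root).
  by rewrite mulr0 add0r.
have r0 : f %% P != 0.
  by apply: contraNneq z0 => r0; rewrite zr r0 rmorph0 horner0.
have [|d [h [H hx0]]] := poly_symbol_ex r0.
  by rewrite -ltnS -size_radical_poly ltn_modp -size_poly_gt0 size_radical_poly.
by exists d, h.[x] => //; exists (f %% P), h.
Qed.

Lemma radical_symbol_poly d z l : radical_symbol d z l ->
  exists f h, [/\ (size f <= p)%N, poly_symbol d f h
    & z = (map_poly (in_alg K') f).[t]].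
Proof.
move=> [f [h [/poly_symbol_reduce[f' [h' [sf' H' /dvdpP[q Pff'] _]]] -> _]]].
exists f', h'; split=> //; rewrite -[f in LHS](subrK f') Pff'.
by rewrite rmorphD rmorphM hornerD hornerM (rootP t_root) mulr0 add0r.
Qed.

End PolynomialSymbols.

(** * Adjoining a p-th root *)

Section RadicalExtension.
Variables (K : fieldType) (G : ordGroupType) (w : valuation K G).
Variables (L : gradedField G) (psi : {rmorphism gr w -> L}).
Hypothesis psi_graded : graded_morphism psi.
Variables (p : nat) (x : L) (g : G) (a : K).
Hypotheses (pF : p \in [pchar gr w]) (hx : gf_hom g x).
Hypothesis Sa : val_symbol psi (g *+ p) a (x ^+ p).
Hypothesis x_notin : ~ exists r, psi r = x.

Let hS := val_symbol_relation psi_graded.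

Lemma val_symbol_powers_free d f h : poly_symbol (val_symbol psi) g d f h ->
  (size f <= p)%N -> h.[x] = 0 -> h = 0.
Proof.
move=> H sf hx0; pose r := \poly_(i < p) (gr_class w (d - g *+ i) f`_i : gr w).
have hr : h = map_poly psi r.
  apply/polyP => i; rewrite coef_map coef_poly; have [_ <-] := H i.
  case: ltnP => // pi; rewrite nth_default ?(leq_trans sf) // gr_class0.
  by [].
have [ga ea] := Sa.
have r0 : r = 0.
  apply: (graded_powers_free psi_graded pF hx (esym ea) x_notin).
    exact: size_poly.
  by rewrite -hr.
by rewrite hr r0 rmorph0.
Qed.

(** The level is the Gauss value of f, the minimum of the values of its
    monomials. *)
Lemma val_symbol_poly_ex (f : {poly K}) : f != 0 -> (size f <= p)%N ->
  exists d h, poly_symbol (val_symbol psi) g d f h /\ h.[x] != 0.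
Proof.
move=> f0 sf; pose I := [seq i <- iota 0 (size f) | f`_i != 0].
have inI i : f`_i != 0 -> i \in I.
  move=> fi; rewrite mem_filter fi mem_iota add0n /=.
  by rewrite ltnNge; apply: contraNN fi => si; rewrite nth_default.
pose e i j := w f`_i + g *+ i <= w f`_j + g *+ j.
have [||| i] := @seq_extremum _ e I (size f).-1.
- by move=> i j; exact: ogle_total.
- by move=> j i k; exact: le_trans.
- by apply: inI; rewrite -lead_coefE lead_coef_eq0.
rewrite mem_filter => /andP[fi _] imin.
pose d := w f`_i + g *+ i.
have ge j : vge w (d - g *+ j) f`_j.
  rewrite /vge; have [//|/= fj] := eqVneq f`_j 0.
  rewrite -(ogle_add (g *+ j)) addrC subrK [X in _ <= X]addrC.
  exact/imin/inI.
pose h := map_poly psi (\poly_(j < size f) (gr_class w (d - g *+ j) f`_j : gr w)).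
have H : poly_symbol (val_symbol psi) g d f h.
  move=> j; split; first exact: ge.
  rewrite coef_map coef_poly; case: ltnP => // fj.
  by rewrite nth_default // gr_class0.
exists d, h; split=> //; apply/eqP => /(val_symbol_powers_free H sf) h0.
have := H i; rewrite h0 coef0 => -[_ /eqP].
rewrite gr_morph_class_eq0 // /vgt (negPf fi) /d addrK ltxx.
by [].
Qed.

(** Since a has symbol x^p, a p-th root t of a gets the symbol x, whether or
    not the characteristic of K is p. The last clause says that the powers of t
    form a norm basis: z has an expression all of whose terms have value at
    least that of z. *)
Lemma radical_extension :
  exists (K' : fieldExtType K) (t : K') (w' : valuation K' G)
    (h : val_extends (in_alg K') id w w') (psi' : {rmorphism gr w' -> L}),
  [/\ \dim {:K'} = p, t ^+ p = a%:A, graded_morphism psi',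
      forall r, psi' (gr_map h r) = psi r &
      val_symbol psi' g t x /\ forall d z, vge w' d z ->
        exists2 f : {poly K}, (size f <= p)%N /\
          (forall i, vge w (d - g *+ i) f`_i) & z = (map_poly (in_alg K') f).[t]].
Proof.
have p_pr := pcharf_prime pF; have p_gt0 := prime_gt0 p_pr.
have p_gt1 := prime_gt1 p_pr.
have P_irr := radical_poly_irreducible hS p_gt0 Sa val_symbol_poly_ex p_gt1.
have [K' dimK' [t t_root t_gen]] := irredp_FAdjoin P_irr.
have hS' := radical_symbol_relation hS hx p_gt0 Sa val_symbol_poly_ex t_root
  t_gen P_irr.
have [w' [psi' [psi'_graded S'P]]] := symbol_valuation hS'.
have S'C d c : vge w d c ->
    vge w' d c%:A /\ psi' (gr_class w' d c%:A) = psi (gr_class w d c).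
  by move=> dc; apply/S'P; apply: radical_symbolC => //; split.
have h : val_extends (in_alg K') id w w'.
  move=> c c0; have wc : vge w (w c) c by rewrite /vge lexx orbT.
  have c'0 : c%:A != 0 :> K' by rewrite scaler_eq0 oner_eq0 orbF.
  have [ge e] := S'C _ _ wc; apply/eqP; rewrite eq_le.
  have := ge; rewrite /vge (negPf c'0) /= => ->; rewrite andbT ogle_leNgt.
  apply/negP => gt; have := gr_morph_class_eq0 psi'_graded ge.
  rewrite e gr_morph_class_eq0 // /vgt (negPf c0) (negPf c'0) ltxx /=.
  by rewrite gt.
exists K', t, w', h, psi'; split=> //.
- by rewrite dimK' size_radical_poly.
- move: (t_root); rewrite /root rmorphB /= map_polyXn map_polyC !hornerE.
  by rewrite subr_eq0 => /eqP.
- apply: (gr_morphism_eq (f := psi' \o gr_map h)) => d c dc /=.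
  by rewrite gr_map_class //; have [] := S'C d c dc.
split.
  apply/S'P; exists 'X, 'X; split; first exact: poly_symbolX.
    by rewrite map_polyX hornerX.
  by rewrite hornerX.
move=> d z dz; have : radical_symbol (val_symbol psi) x g t d z
    (psi' (gr_class w' d z)) by apply/S'P.
case/(radical_symbol_poly hS p_gt0 Sa t_root) => f [k [sf H zE]].
by exists f => //; split=> // i; have [] := H i.
Qed.

End RadicalExtension.

(** * Defectless extensions *)

Lemma free_of_rank_fin (R S : comNzRingType) (phi : R -> S) (J : finType)
    (b : J -> S) :
  (forall y, exists! c : {ffun J -> R}, y = \sum_j phi (c j) * b j) ->
  free_of_rank phi #|J|.
Proof.
move=> bP; exists (b \o enum_val) => y.
have sumE (F : J -> S) : \sum_j F j = \sum_(i < #|J|) F (enum_val i).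
  exact: (reindex _ (onW_bij _ (enum_val_bij J))).
have [c [yE c_uniq]] := bP y; exists [ffun i => c (enum_val i)]; split.
  by rewrite yE sumE; apply: eq_bigr => i _; rewrite ffunE.
move=> c' yE'; have := c_uniq [ffun j => c' (enum_rank j)].
rewrite sumE => ->; last first.
  by rewrite yE'; apply: eq_bigr => i _; rewrite ffunE enum_valK.
by apply/ffunP => i; rewrite !ffunE enum_valK.
Qed.

Lemma free_of_rank_comp (R S T : comNzRingType) (phi : {rmorphism R -> S})
    (psi : {rmorphism S -> T}) m n :
  free_of_rank phi m -> free_of_rank psi n -> free_of_rank (psi \o phi) (m * n).
Proof.
move=> [b bP] [d dP]; rewrite -[m]card_ord -[n]card_ord -card_prod.
apply: (@free_of_rank_fin _ _ _ _ (fun ij => psi (b ij.1) * d ij.2)) => y.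
have sumE (c : 'I_m -> 'I_n -> R) :
    \sum_ij (psi \o phi) (c ij.1 ij.2) * (psi (b ij.1) * d ij.2) =
    \sum_j psi (\sum_i phi (c i j) * b i) * d j.
  rewrite -(pair_bigA _ (fun i j => (psi \o phi) (c i j) * (psi (b i) * d j))).
  rewrite exchange_big; apply: eq_bigr => j _; rewrite rmorph_sum mulr_suml.
  by apply: eq_bigr => i _; rewrite rmorphM mulrA /=.
have [e [yE e_uniq]] := dP y.
have /choice[c cP] : forall j, exists c : {ffun 'I_m -> R},
    unique (fun c : {ffun 'I_m -> R} => e j = \sum_i phi (c i) * b i) c.
  by move=> j; have [c] := bP (e j); exists c.
exists [ffun ij => c ij.2 ij.1]; split.
  rewrite yE (eq_bigr (fun ij => (psi \o phi) (c ij.2 ij.1) *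
    (psi (b ij.1) * d ij.2))) => [|ij _]; last by rewrite ffunE.
  rewrite (sumE (fun i j => c j i)); apply: eq_bigr => j _.
  by have [<-] := cP j.
move=> c' yE'; apply/ffunP => -[i j]; rewrite ffunE /=.
have eE : e = [ffun j => \sum_i phi (c' (i, j)) * b i].
  apply: e_uniq; rewrite yE'.
  transitivity (\sum_ij (psi \o phi) (c' (ij.1, ij.2)) *
      (psi (b ij.1) * d ij.2)); first by apply: eq_bigr => -[].
  rewrite (sumE (fun i j => c' (i, j))).
  by apply: eq_bigr => k _; rewrite ffunE.
have [_ /(_ [ffun i => c' (i, j)]) ->] := cP j; first by rewrite ffunE.
by rewrite eE ffunE; apply: eq_bigr => k _; rewrite ffunE.
Qed.

Lemma has_index_fin (G : zmodType) (A B : G -> Prop) (J : finType) (r : J -> G) :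
  (forall j, A (r j)) -> (forall a, A a -> exists! j, B (a - r j)) ->
  has_index A B #|J|.
Proof.
move=> Ar rP; exists (r \o enum_val); split=> [i|a Aa]; first exact: Ar.
have [j [Bj j_uniq]] := rP a Aa; exists (enum_rank j); split.
  by rewrite /= enum_rankK.
by move=> i /j_uniq ->; rewrite enum_valK.
Qed.

Lemma has_index_trans (G : zmodType) (A B C : G -> Prop) m n :
  (forall a b, A a -> A b -> A (a + b)) -> (forall a b, B a -> B b -> B (a + b)) ->
  (forall b, B b -> A b) -> (forall c, C c -> B c) ->
  has_index A B m -> has_index B C n -> has_index A C (m * n).
Proof.
move=> AD BD BA CB [r [Ar rP]] [s [Bs sP]].
rewrite -[m]card_ord -[n]card_ord -card_prod.
apply: (@has_index_fin _ _ _ _ (fun ij => r ij.1 + s ij.2)) => [ij|a Aa].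
  by apply: AD => //; exact: BA.
have [i [Bi i_uniq]] := rP a Aa; have [j [Cj j_uniq]] := sP _ Bi.
exists (i, j); split=> [|[i' j'] /=]; first by rewrite /= opprD addrA.
rewrite opprD addrA => Cij; have ii' : i = i'.
  by apply: i_uniq; rewrite -[_ - _](subrK (s j')); apply: BD => //; exact: CB.
by rewrite ii' (j_uniq j') // ii'.
Qed.

Section ValueGroup.
Variables (K : fieldType) (G : ordGroupType) (w : valuation K G).

Lemma valX z n : z != 0 -> w (z ^+ n) = w z *+ n.
Proof.
move=> z0; elim: n => [|n IH]; first by rewrite Defs.val1.
by rewrite exprS val_mul ?expf_neq0 // IH mulrS.
Qed.

Lemma value_groupD a b :
  value_group w a -> value_group w b -> value_group w (a + b).
Proof.
move=> [y y0 <-] [z z0 <-]; exists (y * z); rewrite ?val_mul //.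
exact: mulf_neq0.
Qed.

Lemma value_groupN a : value_group w a -> value_group w (- a).
Proof. by move=> [y y0 <-]; exists y^-1; rewrite ?invr_eq0 // valV. Qed.

Lemma value_groupB a b :
  value_group w a -> value_group w b -> value_group w (a - b).
Proof. by move=> ga gb; apply: value_groupD => //; exact: value_groupN. Qed.

Lemma value_groupMn a n : value_group w a -> value_group w (a *+ n).
Proof.
by move=> [y y0 <-]; exists (y ^+ n); rewrite ?expf_neq0 // valX.
Qed.

Lemma vge_value_group a z : vge w a z -> ~ value_group w a -> vgt w a z.
Proof.
rewrite /vge /vgt; have [//|/= z0] := eqVneq z 0.
by rewrite le_eqVlt => /orP[/eqP ea|//] []; exists z.
Qed.

Lemma vgtN_val a z : vge w a z -> ~~ vgt w a z -> z != 0 /\ w z = a.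
Proof.
rewrite /vge /vgt; have [//|/= z0 az za] := eqVneq z 0; split=> //.
by apply/eqP; rewrite eq_le az ogle_leNgt za.
Qed.

Lemma residue_surj (r : residue_field w) : exists u, residue u = r.
Proof. by exists (res_repr r); rewrite res_reprK. Qed.

Lemma residue_eq (u u' : val_ring w) :
  residue u = residue u' <-> vgt w 0 (val u - val u').
Proof.
split=> [e|/[dup] vv _]; last first.
  apply/eqP; rewrite -subr_eq0 -rmorphB residue_eq0.
  by rewrite (rmorphB (val : val_ring w -> K)).
rewrite -(rmorphB (val : val_ring w -> K)) -residue_eq0.
by rewrite rmorphB /= e subrr.
Qed.

End ValueGroup.

Section RadicalDefectless.
Variables (K : fieldType) (G : ordGroupType) (w : valuation K G).
Variables (L : gradedField G) (psi : {rmorphism gr w -> L}).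
Hypothesis psi_graded : graded_morphism psi.
Variables (p : nat) (x : L) (g : G) (a : K).
Hypotheses (pF : p \in [pchar gr w]) (hx : gf_hom g x).
Hypothesis Sa : val_symbol psi (g *+ p) a (x ^+ p).
Hypothesis x_notin : ~ exists r, psi r = x.
Variables (K' : fieldExtType K) (t : K') (w' : valuation K' G).
Variables (h : val_extends (in_alg K') id w w') (psi' : {rmorphism gr w' -> L}).
Hypothesis dimK' : \dim {:K'} = p.
Hypothesis tp : t ^+ p = a%:A.
Hypothesis psi'_graded : graded_morphism psi'.
Hypothesis psi'E : forall r, psi' (gr_map h r) = psi r.
Hypothesis St : val_symbol psi' g t x.
Hypothesis powers_span : forall d z, vge w' d z ->
  exists2 f : {poly K}, (size f <= p)%N /\
    (forall i, vge w (d - g *+ i) f`_i) & z = (map_poly (in_alg K') f).[t].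

Let hS' := val_symbol_relation psi'_graded.

Let p_gt0 : (0 < p)%N. Proof. exact/prime_gt0/(pcharf_prime pF). Qed.

Let hornerE_wide (f : {poly K}) : (size f <= p)%N ->
  (map_poly (in_alg K') f).[t] = \sum_(i < p) (f`_i)%:A * t ^+ i.
Proof.
move=> sf; rewrite (@horner_coef_wide _ p) ?size_map_poly //.
by apply: eq_bigr => i _; rewrite coef_map.
Qed.

Let St_exp i : val_symbol psi' (g *+ i) (t ^+ i) (x ^+ i).
Proof.
elim: i => [|i IH]; first exact: (symbol1 hS').
by rewrite mulrS !exprS; exact: (symbolM hS').
Qed.

(** The norm basis property of the powers of t, in terms of symbols: a sum of
    terms of value at least d has larger value only if all its terms do. *)
Lemma radical_powers_valuation d (f : {poly K}) : (size f <= p)%N ->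
  (forall i, vge w (d - g *+ i) f`_i) ->
  vgt w' d (map_poly (in_alg K') f).[t] -> forall i, vgt w (d - g *+ i) f`_i.
Proof.
move=> sf fge; rewrite hornerE_wide // => fgt i.
pose k := map_poly psi (\poly_(j < p) (gr_class w (d - g *+ j) f`_j : gr w)).
have kE j : k`_j = psi (gr_class w (d - g *+ j) f`_j).
  rewrite coef_map coef_poly; case: ltnP => // pj.
  by rewrite nth_default ?(leq_trans sf) // gr_class0.
have H : poly_symbol (val_symbol psi) g d f k by move=> j; split.
have [fge' kx] : val_symbol psi' d (\sum_(j < p) (f`_j)%:A * t ^+ j) k.[x].
  rewrite (@horner_coef_wide _ p) ?(leq_trans (size_poly _ _)) ?size_poly //.
  apply: symbol_sum => // j _; rewrite -(subrK (g *+ j) d).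
  apply: (symbolM hS'); last exact: St_exp.
  rewrite kE -psi'E; split; first by rewrite (vge_ext h).
  by rewrite gr_map_class.
have k0 : k = 0.
  apply: (val_symbol_powers_free psi_graded pF hx Sa x_notin H sf).
  by rewrite -kx; apply/eqP; rewrite gr_morph_class_eq0.
by rewrite -(gr_morph_class_eq0 psi_graded) // -kE k0 coef0.
Qed.

Let t_val : t != 0 /\ w' t = g.
Proof.
have [gt tx] := St; apply: vgtN_val => //.
rewrite -(gr_morph_class_eq0 psi'_graded) // tx.
by apply/eqP => x0; apply: x_notin; exists 0; rewrite rmorph0.
Qed.

Let value_group_gp : value_group w (g *+ p).
Proof.
have [t0 wt] := t_val; have a0 : a != 0.
  by apply: contraNneq (expf_neq0 p t0) => a0; rewrite tp a0 scale0r.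
by exists a => //; rewrite -(h a0) -wt -valX // tp.
Qed.

Let value_group_radical d : value_group w' d ->
  exists i : 'I_p, value_group w (d - g *+ i).
Proof.
move=> [z z0 zd]; apply: contrapT => no.
have dz : vge w' d z by rewrite /vge zd lexx orbT.
have [f [sf fge] zE] := powers_span dz.
have : vgt w' d z.
  rewrite zE hornerE_wide //; apply: vgt_sum => i _.
  rewrite -(subrK (g *+ i) d); apply: vgtM; last by have [] := St_exp i.
  rewrite (vgt_ext h); apply: vge_value_group => // vi.
  by apply: no; exists i.
by rewrite /vgt (negPf z0) zd ltxx.
Qed.

(** The order of g modulo the value group of w divides the prime p. *)
Let value_group_g_order n : (0 < n < p)%N ->
  value_group w (g *+ n) -> value_group w g.
Proof.
move=> /andP[n0 np] gn; have cop : coprime n p.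
  rewrite coprime_sym prime_coprime ?(pcharf_prime pF) //.
  by rewrite gtnNdvd.
case: (egcdnP p n0) => km kp e _.
have -> : g = g *+ n *+ km - g *+ p *+ kp.
  by rewrite -!mulrnA mulnC e (eqP cop) mulrnDr mulnC addrC addKr.
by apply: value_groupB; apply: value_groupMn.
Qed.

(** If g is not a value of w, terms c t^i with c in K and different i < p have
    values in different cosets, so an element of nonnegative value has the same
    residue as the constant term of its expression. *)
Let ramified_case : ~ value_group w g ->
  free_of_rank (residue_map h) 1 /\ has_index (value_group w') (value_group w) p.
Proof.
move=> g_notin.
have notin (i : 'I_p) : (0 < i)%N -> ~ value_group w (0 - g *+ i).
  move=> i0 /value_groupN; rewrite sub0r opprK => gi.
  by apply: g_notin; apply: value_group_g_order gi; rewrite i0 ltn_ord.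
split.
  exists (fun _ => 1) => y; have [u <-] := residue_surj y.
  have [f [sf fge] uE] := powers_span (valP u).
  have f0 : f`_0 \in val_ring_pred w.
    by have := fge 0%N; rewrite mulr0n subr0.
  have resE : residue u = residue_map h (residue (ValRing f0)).
    rewrite residue_mapE; apply/residue_eq => /=; rewrite uE hornerE_wide //.
    rewrite (bigD1 (Ordinal p_gt0)) //= expr0 mulr1 addrC addrK.
    apply: vgt_sum => i i0; rewrite -(subrK (g *+ i) 0).
    apply: vgtM; last by have [] := St_exp i.
    rewrite (vgt_ext h); apply: vge_value_group; first exact: fge.
    by apply: notin; rewrite lt0n.
  exists [ffun _ => residue (ValRing f0)]; split.
    by rewrite big_ord1 mulr1 ffunE.
  move=> c; rewrite big_ord1 mulr1 => uc; apply/ffunP => i.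
  rewrite ffunE (ord1 i); apply: (fmorph_inj (residue_map h)) => /=.
  by rewrite -resE -uc.
exists (fun i => g *+ i); split=> [i|d /value_group_radical[i di]].
  by apply: value_groupMn; exists t; case: t_val.
exists i; split=> // j dj; apply: val_inj => /=.
have aux (m n : nat) : (m < n < p)%N -> value_group w (d - g *+ m) ->
    value_group w (d - g *+ n) -> False.
  move=> /andP[mn np] dm dn; apply: g_notin.
  apply: (@value_group_g_order (n - m)).
    by rewrite subn_gt0 mn (leq_ltn_trans (leq_subr _ _)).
  have -> : g *+ (n - m) = (d - g *+ m) - (d - g *+ n).
    by rewrite opprB addrC addrA subrK mulrnBr // ltnW.
  exact: value_groupB.
case: (ltngtP i j) => // ij; exfalso.
  by apply: (aux i j _ di dj); rewrite ij ltn_ord.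
by apply: (aux j i _ dj di); rewrite ij ltn_ord.
Qed.

(** If g = w c, the unit t / c has a residue whose powers form a basis of the
    residue field extension. *)
Let inertial_case : value_group w g ->
  free_of_rank (residue_map h) p /\ has_index (value_group w') (value_group w) 1.
Proof.
move=> /[dup] gG [c c0 wc]; have [t0 wt] := t_val; split; last first.
  exists (fun _ => 0); split=> [i|d /value_group_radical[i di]].
    by exists 1; rewrite ?oner_eq0 // Defs.val1.
  exists ord0; split=> [|j _]; last by rewrite (ord1 j).
  rewrite subr0 -(subrK (g *+ i) d); apply: value_groupD => //.
  exact: value_groupMn.
have cA0 : c%:A != 0 :> K' by rewrite scaler_eq0 oner_eq0 orbF.
pose u := t / c%:A; have uO : u \in val_ring_pred w'.
  rewrite val_ringE /vge val_mul ?invr_eq0 // valV // (h c0) wc wt subrr.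
  by rewrite lexx orbT.
pose U := ValRing uO.
have tu i : t ^+ i = (c ^+ i)%:A * u ^+ i.
  rewrite (_ : (c ^+ i)%:A = c%:A ^+ i); last exact: (rmorphXn (in_alg K')).
  by rewrite -exprMn mulrCA mulfV // mulr1.
have val_ci i : w (c ^+ i) = g *+ i by rewrite valX // wc.
have ci0 i : c ^+ i != 0 by rewrite expf_neq0.
have residue_sum (C : 'I_p -> val_ring w) :
    \sum_i residue_map h (residue (C i)) * residue U ^+ i =
    residue (\sum_i val_ring_ext h (C i) * U ^+ i).
  rewrite rmorph_sum; apply: eq_bigr => i _.
  by rewrite residue_mapE rmorphM rmorphXn.
have val_sum (C : 'I_p -> val_ring w) :
    val (\sum_i val_ring_ext h (C i) * U ^+ i) = \sum_i (val (C i))%:A * u ^+ i.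
  rewrite rmorph_sum; apply: eq_bigr => i _.
  by rewrite rmorphM rmorphXn.
exists (fun i => residue U ^+ i) => y; have [z <-] := residue_surj y.
have [f [sf fge] zE] := powers_span (valP z).
have fO i : f`_i * c ^+ i \in val_ring_pred w.
  rewrite val_ringE -(subrK (g *+ i) 0); apply: vgeM => //.
  by rewrite /vge val_ci lexx orbT.
have existence : residue z =
    \sum_(i < p) residue_map h (residue (ValRing (fO i))) * residue U ^+ i.
  rewrite residue_sum; congr residue; apply: val_inj; rewrite val_sum /= zE.
  rewrite hornerE_wide //; apply: eq_bigr => i _.
  rewrite tu mulrA; congr (_ * _).
  by rewrite -(rmorphM (in_alg K')).
exists [ffun i : 'I_p => residue (ValRing (fO i))]; split.
  by rewrite existence; apply: eq_bigr => i _; rewrite ffunE.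
move=> c' zE'; apply/ffunP => i; rewrite ffunE.
(* For two expressions of the residue of z, lift the differences of the
   coefficients to elements r j, and write the sum of the (r j) (t / c)^j as a
   polynomial q in t. *)
pose r (j : 'I_p) := res_repr (residue (ValRing (fO j)) - c' j).
pose q := \poly_(j < p) (if insub j is Some j' then val (r j') / c ^+ j else 0).
have qE (j : 'I_p) : q`_j = val (r j) / c ^+ j.
  by rewrite coef_poly ltn_ord valK.
have qge j : vge w (0 - g *+ j) q`_j.
  case: (ltnP j p) => [jp|pj]; last first.
    by rewrite coef_poly ltnNge pj vge0.
  rewrite -[j in q`_j]/(nat_of_ord (Ordinal jp)) qE; apply: vgeM.
    exact: (valP (r (Ordinal jp))).
  by rewrite /vge valV // val_ci lexx orbT.
have sq : (size q <= p)%N by exact: size_poly.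
have : vgt w' 0 (map_poly (in_alg K') q).[t].
  rewrite hornerE_wide // (_ : \sum_(j < p) _ =
    val (\sum_j val_ring_ext h (r j) * U ^+ j)); last first.
    rewrite val_sum; apply: eq_bigr => j _; rewrite qE tu mulrA.
    congr (_ * _); rewrite -(rmorphM (in_alg K')) /=.
    by rewrite mulfVK.
  rewrite -residue_eq0 -residue_sum.
  rewrite (eq_bigr (fun j : 'I_p => residue_map h (residue (ValRing (fO j))) *
    residue U ^+ j - residue_map h (c' j) * residue U ^+ j)) => [|j _].
    by rewrite sumrB -existence zE' subrr.
  by rewrite res_reprK rmorphB mulrBl.
move=> /(radical_powers_valuation sq qge) /(_ i); rewrite qE => ri.
have : vgt w 0 (val (r i)).
  have := vgtM ri (_ : vge w (g *+ i) (c ^+ i)); rewrite subrK mulfVK //.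
  by apply; rewrite /vge val_ci lexx orbT.
by rewrite -residue_eq0 res_reprK subr_eq0 => /eqP.
Qed.

(** The whole degree p is residue degree or ramification index, according to
    whether the value g of t is a value of w. *)
Lemma radical_defectless : defectless h.
Proof.
have [/inertial_case[f1 e1]|/ramified_case[f1 e1]] := pselect (value_group w g).
  by exists p, 1%N; rewrite muln1.
by exists 1%N, p; rewrite mul1n.
Qed.

End RadicalDefectless.

Section DefectlessTower.
Variables (E : fieldType) (G : ordGroupType) (v : valuation E G).
Variables (K : fieldExtType E) (w : valuation K G) (K' : fieldExtType K).
Variable w' : valuation K' G.
Variables (h : val_extends (in_alg K) id v w) (h' : val_extends (in_alg K') id w w').

Lemma val_extends_base : val_extends (in_alg (baseFieldType K')) id v
  (w' : valuation (baseFieldType K') G).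
Proof.
move=> c c0; rewrite -(h c0) -[RHS]h' //.
by rewrite scaler_eq0 oner_eq0 orbF.
Qed.

Lemma gr_map_base r : gr_map val_extends_base r = gr_map h' (gr_map h r).
Proof.
apply: (gr_morphism_eq (f := gr_map val_extends_base)
  (g := gr_map h' \o gr_map h)) => a z az /=.
by rewrite !gr_map_class // (vge_ext h).
Qed.

Lemma residue_map_base r :
  residue_map val_extends_base r = residue_map h' (residue_map h r).
Proof.
have [u <-] := residue_surj r; rewrite !residue_mapE.
by congr residue; apply: val_inj.
Qed.

Lemma defectless_trans : defectless h -> defectless h' ->
  defectless val_extends_base.
Proof.
move=> [f1 [e1 [F1 I1 D1]]] [f2 [e2 [F2 I2 D2]]].
exists (f1 * f2)%N, (e2 * e1)%N; split.
- have -> : residue_map val_extends_base = residue_map h' \o residue_map h.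
    by apply/funext => r; exact: residue_map_base.
  exact: free_of_rank_comp.
- apply: (has_index_trans _ _ _ _ I2 I1).
  + exact: (@value_groupD K' G w').
  + exact: value_groupD.
  + move=> _ [c c0 <-]; exists c%:A; last exact: h'.
    by rewrite scaler_eq0 oner_eq0 orbF.
  + move=> _ [c c0 <-]; exists c%:A; last exact: h.
    by rewrite scaler_eq0 oner_eq0 orbF.
have := dim_baseVspace (fullv : {vspace K'}); rewrite D1 D2.
have -> : baseVspace {:K'} = fullv.
  apply/vspaceP => z; rewrite mem_baseVspace.
  by transitivity true; [exact: memvf | symmetry; exact: memvf].
by move=> ->; rewrite mulnC mulnACA [(e1 * e2)%N]mulnC.
Qed.

End DefectlessTower.

(** * Lifting a purely wild extension *)

Section GradedApproximation.
Variables (E : fieldType) (G : ordGroupType) (v : valuation E G) (p : nat).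
Variables (L : gradedField G) (iota : {rmorphism gr v -> L}).

(** An extension K whose associated graded field is identified, by psi, with
    a part of L. Pure inseparability is stated through powers, a form that
    passes to a tower. *)
Record approximation (K : fieldExtType E) (w : valuation K G)
    (h : val_extends (in_alg K) id v w) (psi : {rmorphism gr w -> L}) : Prop :=
  Approximation {
    approx_defectless : defectless h;
    approx_graded : graded_morphism psi;
    approx_iota : forall r, psi (gr_map h r) = iota r;
    approx_insep : p \in [pchar E] -> forall z : K, exists k c, z ^+ (p ^ k) = c%:A
  }.

Hypothesis iota_graded : graded_morphism iota.
Hypothesis pF : p \in [pchar gr v].

(** This is E itself. The field underlying the regular extension of E has the
    operations of E but is another structure, so valuation and symbols are
    carried over by hand. *)
Lemma approximation_trivial :
  exists (K : fieldExtType E) (w : valuation K G)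
    (h : val_extends (in_alg K) id v w) (psi : {rmorphism gr w -> L}),
    approximation h psi.
Proof.
have algE (z : E) : in_alg E^o z = z by exact: mulr1.
pose w : valuation E^o G := @Valuation E^o G v (val_mul v) (val_add v).
have h : val_extends (in_alg E^o) id v w by move=> z _; rewrite algE.
have vgeE a (z : E) : vge w a z = vge v a z by [].
have vgtE a (z : E) : vgt w a z = vgt v a z by [].
have [|||| psi psiE] := @gr_lift E^o G w L (fun a z => iota (gr_class v a z)).
- by move=> a y z ay az; rewrite -(rmorphB iota) -gr_classB.
- move=> a z az; rewrite (_ : gr_class _ _ _ = 0) ?(rmorph0 iota) //.
  by apply/eqP; rewrite gr_class_eq0 -?vgtE //; exact: vgtW az.
- by rewrite -[RHS](rmorph1 iota) -gr_class1.
- by move=> a b y z ay bz; rewrite -(rmorphM iota) -gr_classM.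
exists E^o, w, h, psi; split.
- exists 1%N, 1%N; split.
  + exists (fun _ => 1) => y; have [u <-] := residue_surj y.
    have uO : (val u : E) \in val_ring_pred v := valP u.
    have uE : residue u = residue_map h (residue (ValRing uO)).
      rewrite residue_mapE; congr residue; apply: val_inj.
      exact: esym (algE _).
    exists [ffun _ => residue (ValRing uO)]; split.
      by rewrite big_ord1 ffunE mulr1.
    move=> c; rewrite big_ord1 mulr1 => uc; apply/ffunP => i.
    rewrite ffunE (ord1 i); apply: (fmorph_inj (residue_map h)) => /=.
    by rewrite -uE -uc.
  + exists (fun _ => 0); split=> [i|a va].
      by exists 1; [exact: oner_neq0 | exact: (Defs.val1 w)].
    by exists ord0; split=> [|j _]; [rewrite subr0 | rewrite (ord1 j)].
  by rewrite dimvf.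
- by move=> a r /gr_homP[z az ->]; rewrite psiE //; apply/iota_graded/gr_class_hom.
- apply: (gr_morphism_eq (f := psi \o gr_map h)).
  move=> a z az; rewrite /= gr_map_class // -[RHS]psiE //.
  congr (psi (gr_class w a _)); exact: algE.
by move=> _ z; exists 0%N, z; rewrite expr1; symmetry; exact: algE.
Qed.

(** If x is not yet in the image of psi, lift the homogeneous preimage of x^p
    to an element a of K and adjoin a p-th root of a. *)
Lemma approximation_pth_root (K : fieldExtType E) (w : valuation K G)
    (h : val_extends (in_alg K) id v w) (psi : {rmorphism gr w -> L}) g x :
  approximation h psi -> gf_hom g x -> (exists b, psi b = x ^+ p) ->
  exists (K' : fieldExtType E) (w' : valuation K' G)
    (h' : val_extends (in_alg K') id v w') (psi' : {rmorphism gr w' -> L}),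
    [/\ approximation h' psi', forall r, exists r', psi' r' = psi r
      & exists r', psi' r' = x].
Proof.
move=> [K_defectless psi_graded psiE K_insep] hx [b bE].
have [x_in|x_notin] := pselect (exists r, psi r = x).
  by exists K, w, h, psi; split=> // r; exists r.
have pw : p \in [pchar gr w] := rmorph_pchar (gr_map h) pF.
have p_pr := pcharf_prime pF.
have [a Sa] : exists a, val_symbol psi (g *+ p) a (x ^+ p).
  have /gr_homP[a ga ba] := hcomp_hom (g *+ p) b; exists a; split=> //.
  by rewrite -ba graded_morphism_comp // bE hcomp_id //; exact: gf_homX.
have [K' [t [w' [h' [psi' [dimK' tp psi'_graded psi'E [St span]]]]]]] :=
  radical_extension psi_graded pw hx Sa x_notin.
have K'_defectless := radical_defectless psi_graded pw hx Sa x_notin dimK' tp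
  psi'_graded psi'E St span.
exists (baseFieldType K'), w', (val_extends_base h h'), psi'; split.
- split=> //; first exact: defectless_trans.
    by move=> r; rewrite (gr_map_base h h') -psiE -psi'E.
  move=> pE z; have pK' : p \in [pchar K'].
    by rewrite (fmorph_pchar (in_alg K')) (fmorph_pchar (in_alg K)).
  (* By Frobenius, (\sum c_i t^i)^p = \sum c_i^p a^i. *)
  have [c zc] : exists c : K, (z : K') ^+ p = c%:A.
    have /span[f _ ->] : vge w' (w' z) z by rewrite /vge lexx orbT.
    exists (\sum_(i < size (map_poly (in_alg K') f)) f`_i ^+ p * a ^+ i).
    rewrite horner_coef -(pFrobenius_autE pK') rmorph_sum.
    rewrite -[RHS]/(in_alg K' _) rmorph_sum; apply: eq_bigr => i _ /=.
    rewrite pFrobenius_autE coef_map exprMn -exprM mulnC exprM tp.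
    by rewrite -[RHS]/(in_alg K' _) rmorphM !rmorphXn.
  have [k [e ke]] := K_insep pE c; exists k.+1, e.
  rewrite expnS exprM -[(_ : baseFieldType K') ^+ p]/((z : K') ^+ p) zc.
  rewrite baseField_scaleE -ke -[in RHS]/(in_alg K' _) rmorphXn.
  by [].
- by move=> r; exists (gr_map h' r).
by have [_ <-] := St; exists (gr_class w' g t).
Qed.

(** The elements x^(p^i) are reached for decreasing i. *)
Lemma approximation_root k (K : fieldExtType E) (w : valuation K G)
    (h : val_extends (in_alg K) id v w) (psi : {rmorphism gr w -> L}) g x :
  approximation h psi -> gf_hom g x -> (exists b, psi b = x ^+ (p ^ k)) ->
  exists (K' : fieldExtType E) (w' : valuation K' G)
    (h' : val_extends (in_alg K') id v w') (psi' : {rmorphism gr w' -> L}),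
    [/\ approximation h' psi', forall r, exists r', psi' r' = psi r
      & exists r', psi' r' = x].
Proof.
elim: k g x => [|k IH] g x A hx xk.
  by exists K, w, h, psi; split=> // r; exists r.
have [|K1 [w1 [h1 [psi1 [A1 sub1 xp]]]]] := IH _ _ A (gf_homX p hx).
  by rewrite -exprM -expnS.
have [K2 [w2 [h2 [psi2 [A2 sub2 x2]]]]] := approximation_pth_root A1 hx xp.
exists K2, w2, h2, psi2; split=> // r.
by have [r1 <-] := sub1 r; exact: sub2.
Qed.

Lemma approximation_seq (s : seq L) :
  (forall x, x \in s -> exists g, gf_hom g x) ->
  (forall x, x \in s -> exists k b, iota b = x ^+ (p ^ k)) ->
  exists (K : fieldExtType E) (w : valuation K G)
    (h : val_extends (in_alg K) id v w) (psi : {rmorphism gr w -> L}),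
    approximation h psi /\ forall x, x \in s -> exists r, psi r = x.
Proof.
elim: s => [|x s IH] s_hom s_pow.
  by have [K [w [h [psi A]]]] := approximation_trivial; exists K, w, h, psi.
have [y ys|y ys|K [w [h [psi [A sub]]]]] := IH.
- by apply: s_hom; rewrite in_cons ys orbT.
- by apply: s_pow; rewrite in_cons ys orbT.
have [g hx] := s_hom x (mem_head _ _).
have [k [b bE]] := s_pow x (mem_head _ _).
have [|K' [w' [h' [psi' [A' sub' x']]]]] := approximation_root (k := k) A hx.
  by exists (gr_map h b); rewrite (approx_iota A).
exists K', w', h', psi'; split=> // y; rewrite in_cons => /orP[/eqP->//|].
by case/sub => r <-; exact: sub'.
Qed.

Hypothesis L_wild : purely_wild iota p.

(** A p-power multiple of the degree of x is a degree of gr v, so some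
    x^(p^k) is the product of a homogeneous element of gr v and an element of
    L_0, which is purely inseparable over the degree 0 part of gr v. *)
Lemma purely_wild_power g x : gf_hom g x -> exists k b, iota b = x ^+ (p ^ k).
Proof.
move=> hx; have [_ wild0 wild_supp] := L_wild.
have [->|x0] := eqVneq x 0.
  by exists 0%N, 0; rewrite rmorph0 expr1.
have [|k [z z0 hz]] := wild_supp g; first by exists x.
have [z' hz' zz'] := gf_hom_unit hz z0.
have hy : gf_hom 0 (x ^+ (p ^ k) * iota z').
  rewrite -(subrr (g *+ p ^ k)); apply: (homM (gf_grading L)).
    exact: gf_homX.
  exact: iota_graded.
have [m [y _ ym]] := wild0 _ hy.
exists (k + m)%N, (y * z ^+ (p ^ m)).
rewrite rmorphM rmorphXn -ym -exprMn -mulrA -rmorphM [z' * z]mulrC zz'.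
by rewrite rmorph1 mulr1 -exprM -expnD.
Qed.

Lemma approximation_isom (K : fieldExtType E) (w : valuation K G)
    (h : val_extends (in_alg K) id v w) (psi : {rmorphism gr w -> L}) :
  approximation h psi -> (forall x, exists r, psi r = x) ->
  graded_isom (gr_map h) iota.
Proof.
move=> [_ psi_graded psiE _] /choice[f fE]; exists psi.
have psi_inj := graded_morphism_inj psi_graded; split=> //.
  by exists f => // r; apply: psi_inj; rewrite fE.
move=> a r; split=> [|hr]; first exact: psi_graded.
suff -> : r = hcomp a r by exact: hcomp_hom.
by apply: psi_inj; rewrite graded_morphism_comp // hcomp_id.
Qed.

Hypothesis L_finite : exists n, free_of_rank iota n.

(** The homogeneous components of the finitely many members of a basis
    generate L over gr v. *)
Lemma approximation_surj :
  exists (K : fieldExtType E) (w : valuation K G)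
    (h : val_extends (in_alg K) id v w) (psi : {rmorphism gr w -> L}),
    approximation h psi /\ forall x, exists r, psi r = x.
Proof.
have [n [b bP]] := L_finite.
pose s := [seq hcomp a (b i) | i <- enum 'I_n, a <- hsupp (b i)].
have s_hom x : x \in s -> exists g, gf_hom g x.
  by case/allpairsPdep => i [a [_ _ ->]]; exists a; exact: hcomp_hom.
have s_pow x : x \in s -> exists k b, iota b = x ^+ (p ^ k).
  by case/s_hom => g; exact: purely_wild_power.
have [K [w [h [psi [A sub]]]]] := approximation_seq s_hom s_pow.
exists K, w, h, psi; split=> //.
have comp_in i a : exists r, psi r = hcomp a (b i).
  have [sa|/hcomp_out->] := boolP (a \in hsupp (b i)); last first.
    by exists 0; rewrite rmorph0.
  by apply: sub; apply: allpairs_f_dep; rewrite ?mem_enum.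
have /choice[d dE] : forall i, exists r, psi r = b i.
  move=> i; have /choice[e eE] := comp_in i.
  exists (\sum_(a <- hsupp (b i)) e a); rewrite rmorph_sum -[RHS]sum_hcomp.
  by apply: eq_bigr => a _.
move=> x; have [c [-> _]] := bP x.
exists (\sum_i gr_map h (c i) * d i); rewrite rmorph_sum.
by apply: eq_bigr => i _; rewrite rmorphM dE (approx_iota A).
Qed.

End GradedApproximation.

Theorem proposition1p12 (E : fieldType) (G : ordGroupType)
    (v : valuation E G) (p : nat)
    (v_henselian : henselian v)
    (char_residue : p \in [pchar residue_field v])
    (L : gradedField G) (iota : {rmorphism gr v -> L})
    (iota_graded : graded_morphism iota)
    (L_finite : exists n, free_of_rank iota n)
    (L_wild : purely_wild iota p) :
  (exists (K : fieldExtType E) (w : valuation K G)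
      (h : val_extends (in_alg K) id v w),
    defectless h /\ graded_isom (gr_map h) iota) /\
  (p \in [pchar E] ->
   exists (K : fieldExtType E) (w : valuation K G)
      (h : val_extends (in_alg K) id v w),
    [/\ purely_inseparable 1%VS {:K}, defectless h &
        graded_isom (gr_map h) iota]).
Proof.
have [pF _ _] := L_wild.
have [K [w [h [psi [A psi_surj]]]]] :=
  approximation_surj iota_graded pF L_wild L_finite.
have isom := approximation_isom A psi_surj; have [K_defectless _ _ K_insep] := A.
split; first by exists K, w, h.
move=> pE; exists K, w, h; split=> //.
apply/purely_inseparableP => z _; apply/purely_inseparable_elementP_pchar.
have [k [c zc]] := K_insep pE z; exists (p ^ k)%N.
  rewrite pnatX; apply/orP; left; rewrite pnatE ?(pcharf_prime pE) //.
  by rewrite (fmorph_pchar (in_alg K)).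
by rewrite zc; apply/vlineP; exists c.
Qed.
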